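(* Let $\{P_0,P_1\}$ be a symmetric Clifford system on $\mathbb{R}^{2l}$ with $l\ge 3$ (the case $m=1$), and let $$M_+=\{x\in S^{2l-1}:\ \langle P_0x,x\rangle=\langle P_1x,x\rangle=0\}.$$ On $N=S^1\times M_+$ let $J$ be the almost complex structure defined at $(a,x)\in N$ by $$J\varepsilon=\eta,\qquad J\eta=-\varepsilon,\qquad JX=P_0P_1X\ \text{ for } X\in V,$$ where $\varepsilon=\sqrt{-1}\,a\in T_aS^1$, $\eta=P_0P_1x\in T_xM_+$, and $V$ is the orthogonal complement of $\mathrm{Span}\{\eta\}$ in $T_xM_+$. Then $J$ is integrable. Furthermore, $(S^1\times M_+,J,ds^2)$ is a Hermitian manifold, where $ds^2$ is the product metric on $S^1\times M_+$.
   Context: A symmetric Clifford system $\{P_0,P_1\}$ on $\mathbb{R}^{2l}$ is a pair of real symmetric $2l\times 2l$ matrices with $P_iP_j+P_jP_i=2\delta_{ij}I_{2l}$. $S^{2l-1}$ is the unit sphere in $\mathbb{R}^{2l}$ and $S^1$ is the unit circle in $\mathbb{C}$. $M_+$ is the level set $f^{-1}(1)$ of $f=F|_{S^{2l-1}}$, $F(x)=|x|^4-2\sum_{i=0}^1\langle P_ix,x\rangle^2$; it is a smooth submanifold of $S^{2l-1}$ with normal frame $P_0x,P_1x$ (the focal submanifold of OT-FKM type with $m=1$, $(m_1,m_2)=(1,l-2)$). It carries the metric induced from the unit sphere, and $ds^2$ is the product of the standard metric on $S^1$ and this metric. One has $P_0P_1V\subset V$, so $J$ is well defined. An almost complex structure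 is integrable if it is induced from a complex structure (holomorphic atlas). Hermitian means that $J$ is integrable and $ds^2(JX,JY)=ds^2(X,Y)$ for all tangent vectors $X,Y$. *)

(* Defs.v *)
From HB Require Import structures.
From mathcomp Require Import all_boot all_order all_algebra.
From mathcomp Require Import all_classical all_reals all_analysis.
From mathcomp Require Import complex ring.

Set Implicit Arguments.
Unset Strict Implicit.
Unset Printing Implicit Defensive.

Import Order.TTheory GRing.Theory Num.Theory.
Import numFieldNormedType.Exports.

Local Open Scope classical_set_scope.
Local Open Scope ring_scope.

Section Smoothness.
Context {R : realType}.
Implicit Types V W : normedModType R.

(* Meant for [U] open.  In finite dimension, [Ck_on n U f] says that all partial
   derivatives of [f] of order at most [n] exist and are continuous on [U]. *)
Fixpoint Ck_on {V W} (n : nat) (U : set V) (f : V -> W) : Prop :=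
  if n is n'.+1 then
    (forall x, U x -> differentiable f x) /\
    (forall v : V, Ck_on n' U ('D_v f))
  else forall x, U x -> {for x, continuous f}.

Definition Cinf_on {V W} (U : set V) (f : V -> W) : Prop :=
  forall n, Ck_on n U f.

(* Smoothness of a map on an arbitrary subset [A] of a vector space: local
   extendability to a smooth map on an open set of the ambient space. *)
Definition smooth_on {V W} (A : set V) (f : V -> W) : Prop :=
  forall p, A p -> exists O : set V, exists F : V -> W,
    [/\ open O, O p, Cinf_on O F & forall q, A q -> O q -> F q = f q].

(* Velocities at [p] of the smooth curves drawn on [S]; when [S] is an embedded
   submanifold this is its tangent space, seen inside the ambient space. *)
Definition tangent {V} (S : set V) (p : V) : set V :=
  [set v | exists2 e : R, 0 < e & exists g : R -> V,
     [/\ Cinf_on [set t : R | - e < t < e] g, (forall t, - e < t < e -> S (g t)),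
         g 0 = p & derive1 g 0 = v]].

End Smoothness.

(* Multiplication by sqrt(-1) on the complexification [V * V] of [V], the pair
   [(u, v)] standing for [u + sqrt(-1) v]. *)
Definition imul {V : zmodType} (w : V * V) : V * V := (- w.2, w.1).

Section ComplexManifolds.
Context {R : realType}.

(* C^k, as a real normed space. *)
Definition Cvec (k : nat) : normedModType R :=
  ('cV[R]_k * 'cV[R]_k)%type.

Definition complexify k (w : Cvec k) : 'cV[R[i]]_k :=
  \col_j (w.1 j 0 +i* w.2 j 0)%C.
Definition realify k (z : 'cV[R[i]]_k) : Cvec k :=
  (\col_j complex.Re (z j 0), \col_j complex.Im (z j 0)).

(* Frechet differentiability over the field of complex numbers. *)
Definition complex_differentiable (C : numClosedFieldType) k
    (f : 'cV[C]_k -> 'cV[C]_k) (z : 'cV[C]_k) : Prop :=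
  differentiable f z.

Definition holomorphic_on k (U : set (Cvec k)) (f : Cvec k -> Cvec k) : Prop :=
  forall w, U w ->
    complex_differentiable (@complexify k \o f \o @realify k) (complexify w).

Variable V : normedModType R.

Record chart (k : nat) := Chart {
  chart_dom : set V;
  chart_cod : set (Cvec k);
  chart_map : V -> Cvec k;
  chart_inv : Cvec k -> V }.

(* [c] is a diffeomorphism from a relatively open subset of [N] onto an open
   subset of C^k. *)
Definition is_chart (N : set V) k (c : chart k) : Prop :=
  [/\ exists2 O : set V, open O & chart_dom c = N `&` O,
      open (chart_cod c),
      set_fun (chart_dom c) (chart_cod c) (chart_map c) /\
        {in chart_dom c, cancel (chart_map c) (chart_inv c)},
      set_fun (chart_cod c) (chart_dom c) (chart_inv c) /\
        {in chart_cod c, cancel (chart_inv c) (chart_map c)} &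
      smooth_on (chart_dom c) (chart_map c) /\
        smooth_on (chart_cod c) (chart_inv c)].

Definition holomorphic_atlas (N : set V) k (A : set (chart k)) : Prop :=
  [/\ forall c, A c -> is_chart N c,
      forall p, N p -> exists2 c, A c & chart_dom c p &
      forall c d, A c -> A d ->
        holomorphic_on (chart_cod c `&` chart_inv c @^-1` chart_dom d)
          (chart_map d \o chart_inv c)].

(* [J p] is the endomorphism of the tangent space of [N] at [p]; its values
   outside [N] and outside the tangent spaces are irrelevant. *)
Definition induced_by (J : V -> V -> V) k (A : set (chart k)) : Prop :=
  forall c, A c -> forall z, chart_cod c z -> forall v : Cvec k,
    'd (chart_inv c) z (imul v) = J (chart_inv c z) ('d (chart_inv c) z v).

Definition integrable_acs (N : set V) (J : V -> V -> V) : Prop :=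
  exists k, exists2 A : set (chart k), holomorphic_atlas N A & induced_by J A.

Definition hermitian_manifold (N : set V) (J : V -> V -> V)
    (g : V -> V -> V -> R) : Prop :=
  integrable_acs N J /\
  forall p X Y, N p -> tangent N p X -> tangent N p Y ->
    g p (J p X) (J p Y) = g p X Y.

End ComplexManifolds.

Section FocalSubmanifold.
Context {R : realType}.

Definition dot n (x y : 'cV[R]_n) : R := \sum_i x i 0 * y i 0.

Definition symmetric_clifford_system m n (P : 'I_m.+1 -> 'M[R]_n) : Prop :=
  (forall i, (P i)^T = P i) /\
  (forall i j, P i *m P j + P j *m P i = (2 * (i == j)%:R)%:M).

Variables (l : nat) (P : 'I_2 -> 'M[R]_(2 * l)).

Definition Mplus : set 'cV[R]_(2 * l) :=
  [set x | [/\ dot x x = 1, dot (P 0 *m x) x = 0 & dot (P 1 *m x) x = 0]].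

(* The plane [R * R] is the real normed space underlying the complex numbers. *)
Definition circle : set (R * R) := [set a | a.1 ^+ 2 + a.2 ^+ 2 = 1].

Definition ambient : normedModType R := ((R * R) * 'cV[R]_(2 * l))%type.

Definition circle_Mplus : set ambient := circle `*` Mplus.

Definition eta (x : 'cV[R]_(2 * l)) : 'cV[R]_(2 * l) := P 0 *m P 1 *m x.

Definition Vspace (x : 'cV[R]_(2 * l)) : set 'cV[R]_(2 * l) :=
  [set X | tangent Mplus x X /\ dot X (eta x) = 0].

(* Since T_(a,x) (S^1 x M+) is spanned by [epsilon], [eta] and [Vspace x], these
   conditions determine [J] on all the tangent spaces. *)
Definition is_J (J : ambient -> ambient -> ambient) : Prop :=
  forall (a : R * R) (x : 'cV[R]_(2 * l)), circle a -> Mplus x ->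
    let T := tangent circle_Mplus (a, x) in
    [/\ forall (s : R) X Y, T X -> T Y ->
          J (a, x) (s *: X + Y) = s *: J (a, x) X + J (a, x) Y,
        J (a, x) (imul a, 0) = (0, eta x),
        J (a, x) (0, eta x) = - (imul a, 0) &
        forall X, Vspace x X -> J (a, x) (0, X) = (0, P 0 *m P 1 *m X)].

Lemma clifford_sqr : symmetric_clifford_system P ->
  forall i, P i *m P i = 1%:M.
Proof.
case=> _ PP i; have := PP i i.
rewrite eqxx mulr1 -mulr2n -scaler_nat => /(congr1 ( *:%R 2^-1)).
by rewrite scalerA mulVf ?pnatr_eq0 // scale1r scale_scalar_mx mulVf ?pnatr_eq0.
Qed.

Lemma dot_eta x : symmetric_clifford_system P -> dot (eta x) (eta x) = dot x x.
Proof.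
have dotE n (y z : 'cV[R]_n) : dot y z = (y^T *m z) 0 0.
  by rewrite mxE; apply: eq_bigr => i _; rewrite mxE.
move=> HP; rewrite !dotE /eta !trmx_mul !(HP.1) -!mulmxA.
by rewrite (mulmxA (P 0) (P 0)) clifford_sqr // mul1mx mulmxA mulmxA
  -(mulmxA x^T) clifford_sqr // mulmx1.
Qed.

(* The conditions [is_J] are consistent. *)
Lemma is_J_ex : symmetric_clifford_system P -> exists J, is_J J.
Proof.
move=> HP; pose Jp (p X : ambient) : ambient :=
  let s := X.1.1 * (imul p.1).1 + X.1.2 * (imul p.1).2 in
  let t := dot X.2 (eta p.2) in
  ((- (t * (imul p.1).1), - (t * (imul p.1).2)),
   s *: eta p.2 + P 0 *m P 1 *m (X.2 - t *: eta p.2)).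
have dotDZ (s : R) (u v w : 'cV[R]_(2 * l)) :
    dot (s *: u + v) w = s * dot u w + dot v w.
  rewrite /dot mulr_sumr -big_split; apply: eq_bigr => i _.
  by rewrite !mxE mulrDl mulrA.
have dot0 (w : 'cV[R]_(2 * l)) : dot 0 w = 0.
  by rewrite /dot big1 // => i _; rewrite mxE mul0r.
exists Jp => -[a1 a2] x; rewrite /circle /Mplus /= => ca [xx _ _].
have ee : dot (eta x) (eta x) = 1 by rewrite dot_eta.
have aa : a1 * a1 + a2 * a2 = 1 by rewrite -!expr2.
split; rewrite /Jp /=.
- move=> s [[u1 u2] u] [[v1 v2] v] _ _ /=; rewrite dotDZ.
  set p := dot u _; set q := dot v _.
  congr ((_, _), _); rewrite /= ?/(_ *: _) /=; try ring.
  rewrite !mulmxBr !mulmxDr -!scalemxAr.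
  move: (eta x) (_ *m eta x) (_ *m v) (_ *m u) => e Ae Av Au.
  by apply/matrixP => i j; rewrite !mxE; ring.
- by rewrite dot0 !mul0r oppr0 scale0r subr0 mulmx0 addr0 mulrNN addrC aa
    scale1r.
- rewrite ee !mul0r addr0 scale0r add0r !mul1r scale1r subrr mulmx0.
  by congr (_, _); rewrite oppr0.
- by move=> X [_ ->]; rewrite !mul0r oppr0 addr0 !scale0r add0r subr0.
Qed.

(* The Euclidean inner product of the ambient space, which restricts to the
   product of the metrics induced on the circle and on M+. *)
Definition product_metric (p X Y : ambient) : R :=
  (X.1.1 * Y.1.1 + X.1.2 * Y.1.2) + dot X.2 Y.2.

End FocalSubmanifold.

(* Main.v *)
From HB Require Import structures.
Require Import Defs.
From mathcomp Require Import all_boot all_order all_algebra.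
From mathcomp Require Import all_classical all_reals all_analysis.
From mathcomp Require Import complex ring lra zify.

(* The matrix [K = P 0 *m P 1] is an orthogonal complex structure for which
   [P 0] is a real structure, so that R^(2l) = C^l carries the complex quadratic
   form [q] with real part [<P 0 x, x>], and M+ is the link of the null cone
   [q = 0]. The map [(e^(i t), x) |-> e^t x] from S^1 * M+ to the punctured cone,
   well defined locally, sends the given almost complex structure to
   multiplication by [K]; charts of the cone therefore give charts of S^1 * M+.
   Near [x] in M+, the vector [v = P 0 x] (the conjugate of [x]) is null and not
   tangent to the cone, so projecting along the complex line [C v] is a chart of
   the cone, whose inverse [e |-> e - q(e) / (2 b(e, v)) v] is rational; its
   differential commutes with [K] because tangency to the cone and the
   projection determine a tangent vector. *)

Set Implicit Arguments.
Unset Strict Implicit.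
Unset Printing Implicit Defensive.

Import Order.TTheory GRing.Theory Num.Theory.
Import numFieldNormedType.Exports.

Local Open Scope classical_set_scope.
Local Open Scope ring_scope.

(** * Smooth functions *)

(** The exponential makes the radial direction play the role of the circle: up to the factor e^t,
    the map (e^(i t), x) |-> e^t x sends [epsilon] to [x], [eta] to [K x] and fixes [V]. So
    [J epsilon = eta] and [J eta = - epsilon] say how [K] acts on [x] and [K x]. The inverse z |->
    (e^(i ln |z|), z / |z|) is global; only the direct map needs a branch of the argument, fixed on
    a half plane. The direction [Q x] is transverse at [x] because b(x, Q x) = <x, x> = 1. Two
    definitions shape the rest. Tangent vectors are velocities of curves and [is_J] constrains [J]
    on these only, so curves with prescribed velocity must be produced; the projection onto the cone
    yields them. Holomorphy is differentiability over [R[i]], whereas every computation is real,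
    hence the passage through the Cauchy-Riemann equations. *)

Lemma differentiable_from (K : numFieldType) (V W : normedModType K)
    (f : V -> W) (df : {linear V -> W}) x :
  continuous df -> f \o shift x = cst (f x) + df +o_ 0 id ->
  differentiable f x.
Proof.
move=> dfc fE; apply/diff_locallyP.
(* [differentiable] speaks of the chosen map ['d f x]; uniqueness identifies it with [df]. *)
by rewrite (diff_unique dfc fE); split.
Qed.

(** The field is general because [cauchy_riemann] applies this over [R[i]]; the bound [M] supplies
    the continuity of [df]. *)
Lemma differentiable_eps (K : numFieldType) (V W : normedModType K)
    (f : V -> W) (df : {linear V -> W}) x (M : K) :
  0 <= M -> (forall h, `|df h| <= M * `|h|) ->
  (forall e, 0 < e -> exists2 d, 0 < d &
    forall h, `|h| < d -> `|f (h + x) - (f x + df h)| <= e * `|h|) ->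
  differentiable f x.
Proof.
move=> M0 dfM fE; apply: (differentiable_from (df := df)).
  apply: bounded_linear_continuous; apply/linear_boundedP.
  exists M; split=> [|r Mr h]; first exact: ger0_real.
  by apply: le_trans (dfM h) _; rewrite ler_wpM2r// ltW.
apply/eqaddoP => e /fE[d d0 fd]; near=> h.
by apply: fd; near: h; exact: nbhs0_lt.
Unshelve. all: by end_near. Qed.

Section SmoothCalculus.
Context {R : realType}.
Implicit Types V W Z : normedModType R.

Lemma near_eq_differentiable V W (f g : V -> W) x :
  {near x, f =1 g} -> differentiable f x -> differentiable g x.
Proof.
move=> fg /diff_locallyP [dfc fE]; apply: (differentiable_from dfc).
have gx : g x = f x by rewrite (nbhs_singleton fg).
apply/eqaddoP => e e0.
move/eqaddoP : fE => /(_ e e0); apply: filterS2; last first.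
  by move: fg; rewrite (near_shift 0) subr0 => fg; exact: fg.
by move=> y /= fgy; rewrite !fctE /= gx -fgy.
Qed.

Lemma derive_diff V W (f : V -> W) x v df :
  is_diff x f df -> 'D_v f x = df v.
Proof. by move=> fx; rewrite deriveE; [rewrite diff_val|exact: ex_diff]. Qed.

(** ['D_v f] is a total function, while the formulas of the calculus hold on [U] only; since [U] is
    open, each derivative depends on values in [U] alone. Every rule below rewrites its derivative
    through this. *)
Lemma Ck_on_eq n V W (U : set V) (f g : V -> W) :
  open U -> {in U, f =1 g} -> Ck_on n U f -> Ck_on n U g.
Proof.
move=> oU; have near_fg (h k : V -> W) x : {in U, h =1 k} -> U x -> {near x, h =1 k}.
  move=> hk Ux; move: (open_nbhs_nbhs (conj oU Ux)); apply: filterS => y Uy.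
  by rewrite hk // inE.
elim: n f g => [|n IHn] f g fg /=.
  move=> fc x Ux; have fgx : f x = g x by apply: fg; rewrite inE.
  rewrite /prop_for /continuous_at -fgx.
  exact: (cvg_trans (near_eq_cvg (near_fg _ _ _ fg Ux))) (fc x Ux).
move=> [df Df]; split=> [x Ux|v].
  exact: near_eq_differentiable (near_fg _ _ _ fg Ux) (df x Ux).
apply: IHn (Df v) => x; rewrite inE => Ux.
exact: near_eq_derive (near_fg _ _ _ fg Ux).
Qed.

Lemma Ck_onSE n V W (U : set V) (f : V -> W) : Ck_on n.+1 U f <->
  (forall x, U x -> differentiable f x) /\ (forall v, Ck_on n U ('D_v f)).
Proof. by []. Qed.

Lemma Ck_onS n V W (U : set V) (f : V -> W) : Ck_on n.+1 U f -> Ck_on n U f.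
Proof.
elim: n f => [|n IHn] f [df Df]; last by split=> // v; exact: IHn.
by move=> x Ux; exact/differentiable_continuous/df.
Qed.

Lemma Ck_on_sub n V W (U U' : set V) (f : V -> W) :
  U' `<=` U -> Ck_on n U f -> Ck_on n U' f.
Proof.
move=> UU'; elim: n f => [|n IHn] f /=; first by move=> fc x /UU'; exact: fc.
by move=> [df Df]; split=> [x /UU'/df//|v]; exact: IHn.
Qed.

Lemma Cinf_differentiable V W (U : set V) (f : V -> W) x :
  Cinf_on U f -> U x -> differentiable f x.
Proof. by move=> /(_ 1%N) [df _]; exact: df. Qed.

Lemma Ck_on_cst n V W (U : set V) (c : W) : Ck_on n U (cst c).
Proof.
elim: n c => [|n IHn] c /=; first by move=> x _; exact: cvg_cst.
split=> [x _|v]; first exact: differentiable_cst.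
rewrite (_ : (fun x => 'D_v (cst c) x) = cst 0); first exact: IHn.
by apply/funext => x; rewrite derive_cst.
Qed.

Lemma Ck_on_linear n V W (U : set V) (L : {linear V -> W}) :
  continuous L -> Ck_on n U L.
Proof.
move=> Lc; have dL x : differentiable L x by exact: linear_differentiable.
case: n => [|n] /=; first by move=> x _; exact: Lc.
split=> // v; rewrite (_ : (fun x => 'D_v L x) = cst (L v)); first exact: Ck_on_cst.
by apply/funext => x; rewrite deriveE// diff_lin.
Qed.

Lemma Ck_on_id n V (U : set V) : Ck_on n U (fun x => x).
Proof. by apply: (@Ck_on_linear _ _ _ _ idfun) => x. Qed.

Lemma Ck_on_comp_linear n V W Z (U : set V) (f : V -> W) (L : {linear W -> Z}) :
  open U -> continuous L -> Ck_on n U f -> Ck_on n U (L \o f).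
Proof.
move=> oU Lc; elim: n f => [|n IHn] f /=.
  by move=> fc x Ux; apply: continuous_comp; [exact: fc|exact: Lc].
have dL x : differentiable L x by exact: linear_differentiable.
move=> [df Df]; split=> [x Ux|v]; first by apply: differentiable_comp; [exact: df|].
apply: (@Ck_on_eq _ _ _ _ (L \o 'D_v f)) => // [x|]; last exact: IHn.
rewrite inE => Ux; have dfx := differentiableP (df x Ux).
rewrite (derive_diff v (is_diff_comp dfx (differentiableP (dL _)))) /=.
by rewrite (derive_diff v dfx) diff_lin.
Qed.

Lemma Ck_on_pair n V W Z (U : set V) (f : V -> W) (g : V -> Z) :
  open U -> Ck_on n U f -> Ck_on n U g -> Ck_on n U (fun x => (f x, g x)).
Proof.
move=> oU; elim: n f g => [|n IHn] f g /=.
  by move=> fc gc x Ux; apply: cvg_pair; [exact: fc|exact: gc].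
move=> [df Df] [dg Dg]; split=> [x Ux|v].
  by apply: differentiable_pair; [exact: df|exact: dg].
apply: (@Ck_on_eq _ _ _ _ (fun x => ('D_v f x, 'D_v g x))) => // [x|]; last exact: IHn.
rewrite inE => Ux.
have dfx := differentiableP (df x Ux); have dgx := differentiableP (dg x Ux).
by rewrite (derive_diff v (is_diff_pair dfx dgx)) (derive_diff v dfx) (derive_diff v dgx).
Qed.

Lemma Ck_onD n V W (U : set V) (f g : V -> W) :
  open U -> Ck_on n U f -> Ck_on n U g -> Ck_on n U (fun x => f x + g x).
Proof.
move=> oU; elim: n f g => [|n IHn] f g /=.
  by move=> fc gc x Ux; apply: cvgD; [exact: fc|exact: gc].
move=> [df Df] [dg Dg]; split=> [x Ux|v].
  by apply: differentiableD; [exact: df|exact: dg].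
apply: (@Ck_on_eq _ _ _ _ (fun x => 'D_v f x + 'D_v g x)) => // [x|]; last exact: IHn.
rewrite inE => Ux.
have dfx := differentiableP (df x Ux); have dgx := differentiableP (dg x Ux).
by rewrite (derive_diff v (is_diffD dfx dgx)) (derive_diff v dfx) (derive_diff v dgx).
Qed.

(** * Product rules, all instances of one rule for continuous bilinear maps *)

Section Bilinear.
Context {V1 V2 W : normedModType R} (B : {bilinear V1 -> V2 -> W}).
Hypothesis Bc : continuous (fun p : V1 * V2 => B p.1 p.2).

Lemma is_diff_bilinear V (f df : V -> V1) (g dg : V -> V2) x :
  is_diff x f df -> is_diff x g dg ->
  is_diff x (fun y => B (f y) (g y)) (fun v => B (df v) (g x) + B (f x) (dg v)).
Proof.
move=> fx gx; have dB p : is_diff p (fun q : V1 * V2 => B q.1 q.2)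
    (fun q => B p.1 q.2 + B q.1 p.2).
  by apply: DiffDef; [exact: differentiable_bilin|rewrite diff_bilin].
have /is_diff_eq := is_diff_comp (is_diff_pair fx gx) (dB (f x, g x)); apply.
by apply/funext => v /=; rewrite addrC.
Qed.

Lemma Ck_on_bilinear n V (U : set V) (f : V -> V1) (g : V -> V2) :
  open U -> Ck_on n U f -> Ck_on n U g -> Ck_on n U (fun x => B (f x) (g x)).
Proof.
move=> oU; elim: n f g => [|n IHn] f g.
  move=> fc gc x Ux.
  by apply: (@continuous_comp _ _ _ (fun x => (f x, g x)) (fun p => B p.1 p.2));
    [apply: cvg_pair; [exact: fc|exact: gc]|exact: Bc].
move=> cf cg; move: (cf) (cg) => /Ck_onSE[df Df] /Ck_onSE[dg Dg].
have dB x (Ux : U x) :=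
  is_diff_bilinear (differentiableP (df x Ux)) (differentiableP (dg x Ux)).
split=> [x Ux|v]; first exact: (@ex_diff _ _ _ _ _ _ _ (dB x Ux)).
apply: (@Ck_on_eq _ _ _ _ (fun x => B ('D_v f x) (g x) + B (f x) ('D_v g x))) => //.
  move=> x; rewrite inE => Ux; rewrite (derive_diff v (dB x Ux)).
  rewrite (derive_diff v (differentiableP (df x Ux))).
  by rewrite (derive_diff v (differentiableP (dg x Ux))).
apply: Ck_onD => //; apply: IHn; [exact: Df|exact: Ck_onS cg|exact: Ck_onS cf|exact: Dg].
Qed.
End Bilinear.

Lemma scale_is_bilinear V :
  bilinear_for (GRing.Scale.Law.clone _ _ *:%R _) (GRing.Scale.Law.clone _ _ *:%R _)
    (@GRing.scale R V).
Proof.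
split=> [u'|u] a x y /=; first by rewrite scalerDl scalerA.
by rewrite scalerDr !scalerA mulrC.
Qed.
HB.instance Definition _ V := bilinear_isBilinear.Build R R V V _ _
  (@GRing.scale R V) (@scale_is_bilinear V).

Lemma is_diff_scale V W (f df : V -> R) (g dg : V -> W) x :
  is_diff x f df -> is_diff x g dg ->
  is_diff x (fun y => f y *: g y) (fun v => df v *: g x + f x *: dg v).
Proof. by apply: (is_diff_bilinear (B := @GRing.scale R W)) => p; exact: scale_continuous. Qed.

Lemma Ck_on_scale n V W (U : set V) (f : V -> R) (g : V -> W) :
  open U -> Ck_on n U f -> Ck_on n U g -> Ck_on n U (fun x => f x *: g x).
Proof. by apply: (Ck_on_bilinear (B := @GRing.scale R W)) => p; exact: scale_continuous. Qed.

Lemma Ck_onM n V (U : set V) (f g : V -> R) :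
  open U -> Ck_on n U f -> Ck_on n U g -> Ck_on n U (fun x => f x * g x).
Proof. by apply: (Ck_on_bilinear (B := @GRing.mul R)) => p; exact: mul_continuous. Qed.

Lemma Ck_onZ n V W (U : set V) k (f : V -> W) :
  open U -> Ck_on n U f -> Ck_on n U (fun x => k *: f x).
Proof. by move=> oU cf; apply: Ck_on_scale => //; exact: Ck_on_cst. Qed.

Lemma Ck_onN n V W (U : set V) (f : V -> W) :
  open U -> Ck_on n U f -> Ck_on n U (fun x => - f x).
Proof.
move=> oU cf; rewrite (_ : (fun _ => _) = fun x => -1 *: f x); first exact: Ck_onZ.
by apply/funext => x; rewrite scaleN1r.
Qed.

(** With a scalar outer function the derivative is ['D_v f] times [phi' (f x)], again a product with
    a composite of the same kind, so the induction closes once [phi] is general. *)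
Lemma Ck_on_comp1 n V (U : set V) (D : set R) (phi : R -> R) (f : V -> R) :
  open U -> (forall x, U x -> D (f x)) ->
  Ck_on n D phi -> Ck_on n U f -> Ck_on n U (fun x => phi (f x)).
Proof.
move=> oU UD; elim: n phi => [|n IHn] phi.
  by move=> pc fc x Ux; apply: (@continuous_comp _ _ _ f phi);
    [exact: fc|exact/pc/UD].
move=> cp cf; move: (cp) (cf) => /Ck_onSE[dp Dp] /Ck_onSE[df Df]; split=> [x Ux|v].
  by apply: (@differentiable_comp _ _ _ _ f phi); [exact: df|exact/dp/UD].
apply: (@Ck_on_eq _ _ _ _ (fun x => 'D_v f x *: 'D_1 phi (f x))) => //.
  move=> x; rewrite inE => Ux; have dfx := differentiableP (df x Ux).
  have dpx := differentiableP (dp _ (UD x Ux)).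
  rewrite (derive_diff v dfx) (derive_diff (1 : R) dpx) -linearZ /= -[_ *: _]/(_ * 1) mulr1.
  by rewrite (derive_diff v (is_diff_comp dfx dpx)).
apply: Ck_on_scale => //.
by apply: (IHn ('D_(1 : R) phi)); [exact: Dp|exact: Ck_onS cf].
Qed.

Lemma deriveZ1 (phi : R -> R) t v : differentiable phi t ->
  'D_v phi t = v * 'D_1 phi t.
Proof.
move=> /differentiableP dp; rewrite (derive_diff v dp) (derive_diff (1 : R) dp).
by rewrite -[v in LHS]mulr1 -[v * 1]/(v *: (1:R)) linearZ.
Qed.

Lemma Ck_on_derive1 n (D : set R) (phi dphi : R -> R) :
  open D -> (forall t, D t -> is_derive t 1 phi (dphi t)) ->
  Ck_on n D dphi -> Ck_on n.+1 D phi.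
Proof.
move=> oD dp cp; have dpt t : D t -> differentiable phi t.
  by move=> Dt; apply/derivable1_diffP; case: (dp t Dt).
split=> // v; apply: (@Ck_on_eq _ _ _ _ (fun t => v * dphi t)) => //.
  move=> t; rewrite inE => Dt /=; rewrite [RHS]deriveZ1//; last exact: dpt.
  by have [_ ->] := dp t Dt.
by apply: Ck_onM => //; exact: Ck_on_cst.
Qed.

(** * Smoothness of the elementary functions *)

Lemma Cinf_expR : Cinf_on setT (@expR R).
Proof.
elim=> [|n IHn]; first by move=> x _; exact: continuous_expR.
exact: (@Ck_on_derive1 _ _ _ expR openT).
Qed.

Lemma Ck_on_cos_sin n : Ck_on n setT (@cos R) /\ Ck_on n setT (@sin R).
Proof.
elim: n => [|n [IHc IHs]].
  by split=> x _; [exact: continuous_cos|exact: continuous_sin].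
split; last exact: (@Ck_on_derive1 _ _ _ cos openT).
by apply: (@Ck_on_derive1 _ _ _ (fun x => - sin x) openT) => //; exact: (Ck_onN openT).
Qed.

Lemma open_neq0 : open [set t : R | t != 0].
Proof.
by rewrite (_ : mkset _ = ~` [set 0]) ?openC; [exact: closed_eq|];
   apply/seteqP; split=> t /= /eqP.
Qed.

Lemma Ck_on_inv n : Ck_on n [set t : R | t != 0] (fun t => t^-1).
Proof.
have o0 := open_neq0.
elim: n => [|n IHn]; first by move=> x /= x0; exact: inv_continuous.
(* The derivative is written with inverses only, so that the induction hypothesis covers it. *)
apply: (@Ck_on_derive1 _ _ _ (fun t => - (t^-1 * t^-1))) => //; last first.
  by apply: Ck_onN => //; apply: Ck_onM.
move=> t /= t0; apply: (is_derive_eq (is_deriveV (f := id) t0 (is_derive_id _ _))).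
by rewrite -[LHS]/(_ * 1) mulr1 /= expr2 invfM.
Qed.

Lemma Ck_on_ln n : Ck_on n [set t : R | 0 < t] (@ln R).
Proof.
have o0 : open [set t : R | 0 < t] by exact: open_gt.
elim: n => [|n IHn]; first by move=> x /= x0; exact: continuous_ln.
apply: (@Ck_on_derive1 _ _ _ (fun t => t^-1)) => //.
by apply: Ck_on_sub (Ck_on_inv n) => t /= /lt0r_neq0.
Qed.

Lemma Cinf_atan : Cinf_on setT (@atan R).
Proof.
case=> [|n]; first by move=> x _; exact: continuous_atan.
apply: (@Ck_on_derive1 _ _ _ _ openT (fun t _ => is_derive1_atan t)).
apply: (Ck_on_comp1 openT _ (Ck_on_inv n)) => [t _ /=|].
  by rewrite lt0r_neq0// ltr_wpDr ?sqr_ge0.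
apply: (Ck_onD openT); first exact: Ck_on_cst.
by apply: (Ck_onM openT); exact: Ck_on_id.
Qed.

End SmoothCalculus.

(** * The Cauchy-Riemann equations *)

Lemma le_mx_norm (K : numFieldType) m n (x : 'M[K]_(m, n)) i j : `|x i j| <= `|x|.
Proof.
rewrite [leRHS]/Num.Def.normr /= mx_normE -[leLHS]nngE num_le.
exact: (le_bigmax _ (fun ij : 'I_m * 'I_n => `|x ij.1 ij.2|%:nng) (i, j)).
Qed.

Lemma mx_norm_le (K : numFieldType) m n (x : 'M[K]_(m, n)) e :
  0 <= e -> (forall i j, `|x i j| <= e) -> `|x| <= e.
Proof.
move=> e0 xe; rewrite [leLHS]/Num.Def.normr /= mx_normE.
rewrite -[e]/(NngNum e0)%:num num_le; apply/bigmax_leP; split=> // -[i j] _.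
by rewrite -num_le /=; exact: xe.
Qed.

Section CauchyRiemann.
Context {R : realType} {k : nat}.
Local Lemma normc_i : `|'i%C : R[i]| = 1.
Proof. by rewrite normc_def /= expr0n expr1n add0r sqrtr1. Qed.

Implicit Types (w v : @Cvec R k) (z : 'cV[R[i]]_k).

Lemma complexifyK w : realify (complexify w) = w.
Proof. by case: w => a b; congr (_, _); apply/colP => j; rewrite !mxE. Qed.

Lemma realifyK z : complexify (realify z) = z.
Proof. by apply/colP => j; rewrite !mxE; case: (z j 0). Qed.

Lemma realifyD z1 z2 : realify (z1 + z2) = realify z1 + realify z2.
Proof.
by congr (_, _); apply/colP => j; rewrite !mxE raddfD.
Qed.

Lemma realify_scale (c : R[i]) z : realify (c *: z) =
  complex.Re c *: realify z + complex.Im c *: imul (realify z).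
Proof.
by case: c => a b; congr (_, _); apply/colP => j; rewrite !mxE; case: (z j 0) => c d /=;
  ring.
Qed.

Lemma complexifyD w1 w2 : complexify (w1 + w2) = complexify w1 + complexify w2.
Proof. by rewrite -[LHS](realifyK) -[RHS]realifyK realifyD !complexifyK. Qed.

Lemma complexify_scale (c : R[i]) w : complexify
  (complex.Re c *: w + complex.Im c *: imul w) = c *: complexify w.
Proof. by rewrite -[RHS]realifyK realify_scale complexifyK. Qed.

Lemma realify_norm z : (`|realify z|)%:C%C <= `|z|.
Proof.
suff : `|realify z| <= complex.Re `|z|.
  move=> h; rewrite -(RRe_real (normr_real z)) lecE /= eqxx /=; exact: h.
have z0 : 0 <= complex.Re `|z| by have := normr_ge0 z; rewrite lecE => /andP[].
have zj j (f : R[i] -> R) : (`|f (z j 0)|)%:C%C <= `|z j 0| ->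
    `|f (z j 0)| <= complex.Re `|z|.
  move=> fz; have := le_trans fz (le_mx_norm z j 0).
  by rewrite lecE => /andP[].
rewrite prod_normE ge_max; apply/andP; split; apply: mx_norm_le => // i j;
  rewrite !mxE; apply: (zj i).
- exact: normc_ge_Re.
- rewrite -normrN -ReiNIm; apply: le_trans (normc_ge_Re _) _.
  by rewrite normrM normc_i mulr1.
Qed.

(** The norm of [Cvec k] is the larger of the two sup norms, and |a + i b| <= |a| + |b|; hence the
    2. *)
Lemma complexify_norm w : `|complexify w| <= (2 * `|w|)%:C%C.
Proof.
apply: mx_norm_le => [|i j]; first by rewrite lecR mulr_ge0.
rewrite [X in `|X|]complexE !mxE /= ; apply: le_trans (ler_normD _ _) _.
rewrite normrM normc_i mul1r !normc_def /= !expr0n /= !addr0 !sqrtr_sqr.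
rewrite -rmorphD lecR mulr_natl mulr2n lerD// prod_normE le_max;
  by rewrite !le_mx_norm ?orbT.
Qed.

(** Commuting with [imul] makes the real differential linear over [R[i]] after [complexify]; the
    first-order estimate then transfers because the two norms are equivalent. *)
Lemma cauchy_riemann (f : @Cvec R k -> @Cvec R k) w : differentiable f w ->
  (forall v, 'd f w (imul v) = imul ('d f w v)) ->
  complex_differentiable (@complexify R k \o f \o @realify R k) (complexify w).
Proof.
move=> df CR; pose g := @complexify R k \o 'd f w \o @realify R k.
have g_lin : linear g.
  move=> c x y; rewrite /g /= realifyD realify_scale !linearD !linearZ /= CR.
  by rewrite complexifyD complexify_scale.
pose gM := GRing.isLinear.Build _ _ _ _ _ g_lin.
pose gL : {linear 'cV[R[i]]_k -> 'cV[R[i]]_k} := HB.pack g gM.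
have cdf := diff_continuous df.
have [M M0 dM] := linear_lipschitz cdf.
have normg z : `|gL z| <= (2 * M)%:C%C * `|z|.
  rewrite /gL /= /g /=; apply: le_trans (complexify_norm _) _.
  rewrite !rmorphM /= -mulrA ler_wpM2l ?lecR//.
  apply: le_trans (_ : (M * `|realify z|)%:C%C <= _); first by rewrite lecR.
  by rewrite rmorphM /= ler_wpM2l ?realify_norm// lecR ltW.
apply: (differentiable_eps (df := gL) _ normg); first by rewrite lecR mulr_ge0// ltW.
move=> e e0.
(* In the order of [R[i]], a positive element is real. *)
have [e' e'0 ee] : exists2 e' : R, 0 < e' & e = e'%:C%C.
  exists (complex.Re e); first by move: e0; rewrite ltcE => /andP[].
  by rewrite RRe_real ?gtr0_real.
(* The half absorbs the constant 2 of [complexify_norm]. *)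
have /eqaddoP /(_ (e' / 2)) := diff_locally df.
rewrite divr_gt0// => /(_ isT) /nbhs_ballP[d /= d0 fd].
exists d%:C%C => [|z zd] /=; first by rewrite ltcR.
have /fd : ball (0 : Cvec k) d (realify z).
  rewrite -ball_normE /= sub0r normrN -ltcR.
  exact: le_lt_trans (realify_norm z) zd.
rewrite /= !fctE /= => fz; rewrite ?complexifyK.
rewrite !realifyD !complexifyK /g /=.
set A := f _; set B := f _; set C := 'd f w _.
have -> : complexify A - (complexify B + complexify C) = complexify (A - (B + C)).
  apply/eqP; rewrite subr_eq -!complexifyD; apply/eqP; congr complexify.
  by rewrite subrK.
apply: le_trans (complexify_norm _) _.
apply: le_trans (_ : (e' * `|realify z|)%:C%C <= _).
  by rewrite lecR mulrC -ler_pdivlMr// mulrAC.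
by rewrite ee rmorphM /= ler_wpM2l ?realify_norm// lecR ltW.
Qed.

End CauchyRiemann.

(** * Complex bases *)

Section ComplexBasis.
Context {F : realFieldType} {n : nat} (K : 'M[F]_n).
Hypothesis KK : K *m K = - 1%:M.

Let KKv m (u : 'M[F]_(m, n)) : u *m K *m K = - u.
Proof. by rewrite -mulmxA KK mulmxN mulmx1. Qed.

(* A vector outside a [K]-stable subspace spans a complex line that meets it
   trivially: multiply [c u + d u K] by [c - d K]. *)
Lemma complex_line_free (m : nat) (S : 'M[F]_(m, n)) (u : 'rV[F]_n) (c d : F) :
  stablemx S K -> ~~ (u <= S)%MS -> ((c *: u + d *: (u *m K))%R <= S)%MS ->
  c = 0 /\ d = 0.
Proof.
move=> SK uS wS; have [|cd0] := eqVneq (c ^+ 2 + d ^+ 2) 0.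
  move/eqP; rewrite paddr_eq0 ?sqr_ge0// !sqrf_eq0.
  by case/andP => /eqP -> /eqP ->.
case/negP: uS; set w := _ + _ in wS.
have -> : u = (c ^+ 2 + d ^+ 2)^-1 *: (c *: w - d *: (w *m K)).
  rewrite /w mulmxDl -!scalemxAl KKv; move: (u *m K) => uK.
  by apply/matrixP => i j; rewrite !mxE; field.
apply/scalemx_sub/addmx_sub; first exact: scalemx_sub.
by rewrite -scaleNr; apply/scalemx_sub/(submx_trans _ SK)/submxMr.
Qed.

(** Real generators of a complex span. The line of [v] is kept apart because it will be the
    direction of projection. *)
Definition complex_span m (A : 'M[F]_(m, n)) (v : 'rV[F]_n) :
    'M[F]_((m + m) + (1 + 1), n) :=
  col_mx (col_mx A (A *m K)) (col_mx v (v *m K)).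

Lemma mul_complex_span m (A : 'M[F]_(m, n)) v (a b : 'rV_m) (c d : 'rV_1) :
  row_mx (row_mx a b) (row_mx c d) *m complex_span A v =
  a *m A + b *m A *m K + c 0 0 *: v + d 0 0 *: (v *m K).
Proof.
rewrite !mul_row_col mulmxA -!addrA; congr (_ + (_ + _)).
by rewrite -!mul_scalar_mx -!mx11_scalar.
Qed.

Lemma complex_span_stable m (A : 'M[F]_(m, n)) v : stablemx (complex_span A v) K.
Proof.
apply/row_subP => i; set r := row i _.
have [r' ->] : exists r', r = r' *m complex_span A v *m K.
  by exists (delta_mx 0 i); rewrite -mulmxA -rowE.
rewrite -[r']hsubmxK -[lsubmx r']hsubmxK -[rsubmx r']hsubmxK mul_complex_span.
move: (lsubmx (lsubmx _)) (rsubmx (lsubmx _)) (lsubmx (rsubmx _)) (rsubmx (rsubmx _)).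
move=> a b c d; apply/submxP.
(* Multiplication by i turns the coordinates a + i b into - b + i a. *)
exists (row_mx (row_mx (- b) a) (row_mx (- d) c)).
rewrite mul_complex_span !mulmxDl -!scalemxAl !KKv.
rewrite !mulNmx !mxE scaleNr scalerN; move: (a *m A *m K) (b *m A) (v *m K) => x y z.
by apply/matrixP => i' j; rewrite !mxE; ring.
Qed.

(** A free complex family is extended one vector at a time: any [u] outside the stable span adds a
    complex line that meets it in 0. *)
Lemma complex_free_family m (v : 'rV[F]_n) : v != 0 -> (2 * m.+1 <= n)%N ->
  exists A : 'M[F]_(m, n), row_free (complex_span A v).
Proof.
move=> v0; elim: m => [|m IHm] mn.
  exists 0; apply: inj_row_free => r.
  rewrite -[r]hsubmxK -[lsubmx r]hsubmxK -[rsubmx r]hsubmxK mul_complex_span.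
  rewrite !mulmx0 mul0mx !add0r => cd.
  have [|||c0 d0] := @complex_line_free 1 (0 : 'M[F]_(1, n)) v (lsubmx (rsubmx r) 0 0)
    (rsubmx (rsubmx r) 0 0).
  - by rewrite mul0mx sub0mx.
  - by apply: contra v0 => /submxP[D ->]; rewrite mulmx0.
  - by rewrite cd sub0mx.
  rewrite (_ : lsubmx (rsubmx r) = 0); last by apply/rowP => i; rewrite ord1 c0 mxE.
  rewrite (_ : rsubmx (rsubmx r) = 0); last by apply/rowP => i; rewrite ord1 d0 mxE.
  rewrite (_ : lsubmx (lsubmx r) = 0); last by apply/rowP => -[].
  rewrite (_ : rsubmx (lsubmx r) = 0); last by apply/rowP => -[].
  by rewrite !row_mx0.
have [|A freeA] := IHm; first by lia.
have [u uA] : exists u : 'rV_n, ~~ (u <= complex_span A v)%MS.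
  suff /existsNP[u /negP uA] : ~ forall u : 'rV_n, (u <= complex_span A v)%MS by exists u.
  (* The span has 2 m + 2 generators, fewer than [n]. *)
  move=> uA; have /mxrankS : (1%:M <= complex_span A v)%MS.
    by apply/row_subP => i; exact: uA.
  by rewrite mxrank1; have := rank_leq_row (complex_span A v); lia.
exists (col_mx u A : 'M[F]_(1 + m, n)); apply: inj_row_free => r.
rewrite -[r]hsubmxK -[lsubmx r]hsubmxK -[rsubmx r]hsubmxK mul_complex_span.
move: (lsubmx (lsubmx r)) (rsubmx (lsubmx r)) (lsubmx (rsubmx r)) (rsubmx (rsubmx r)).
move=> x y c d; rewrite -[x](@hsubmxK _ 1 1 m) -[y](@hsubmxK _ 1 1 m).
move: (lsubmx (x : 'rV[F]_(1 + m))) (rsubmx (x : 'rV[F]_(1 + m)))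
  (lsubmx (y : 'rV[F]_(1 + m))) (rsubmx (y : 'rV[F]_(1 + m))) => a0 a b0 b r0.
have r0' : a0 0 0 *: u + b0 0 0 *: (u *m K) +
    row_mx (row_mx a b) (row_mx c d) *m complex_span A v = 0.
  rewrite -[RHS]r0 mul_complex_span (mul_row_col a0 a u A) (mul_row_col b0 b u A) !mulmxDl.
  rewrite -!mul_scalar_mx -!mx11_scalar !mulmxA.
  move: (a0 *m u) (b0 *m u *m K) (a *m A) (b *m A *m K) => x1 x2 x3 x4.
  by apply/matrixP => i j; rewrite !mxE; ring.
have [|a00 b00] := complex_line_free (c := a0 0 0) (d := b0 0 0)
    (@complex_span_stable _ A v) uA.
  by move/eqP: r0'; rewrite addr_eq0 -mulNmx => /eqP ->; exact: submxMl.
have a0E : a0 = 0 by apply/rowP => i; rewrite ord1 a00 mxE.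
have b0E : b0 = 0 by apply/rowP => i; rewrite ord1 b00 mxE.
rewrite a00 b00 !scale0r !add0r in r0'.
have : row_mx (row_mx a b) (row_mx c d) = 0.
  by apply: (row_free_inj freeA); rewrite r0' mul0mx.
move/eqP; rewrite !row_mx_eq0 => /andP[/andP[/eqP -> /eqP ->] /andP[/eqP -> /eqP ->]].
by rewrite a0E b0E !row_mx0.
Qed.

End ComplexBasis.

(** A complex basis containing [v] is an invertible matrix, and [B1], [B2] read the real and
    imaginary coordinates off [v] in its inverse. The transposes pass from row spaces to column
    vectors. *)
Lemma complex_complement (F : realFieldType) n m (K : 'M[F]_n) (v : 'cV[F]_n) :
  K *m K = - 1%:M -> v != 0 -> n = (2 * m.+1)%N ->
  exists (A : 'M[F]_(n, m)) (B1 B2 : 'M[F]_(m, n)),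
    (forall z, exists c d, z = A *m (B1 *m z) + K *m A *m (B2 *m z) +
       c *: v + d *: (K *m v)) /\
    (forall u1 u2 c d,
       let z := A *m u1 + K *m A *m u2 + c *: v + d *: (K *m v) in
       B1 *m z = u1 /\ B2 *m z = u2).
Proof.
move=> KK v0 nE.
have KKT : K^T *m K^T = - 1%:M by rewrite -trmx_mul KK linearN /= trmx1.
have vT0 : v^T != 0 by rewrite -trmx0 (inj_eq trmx_inj).
have [|A freeA] := complex_free_family KKT (m := m) vT0; first by lia.
set S := complex_span K^T A v^T in freeA.
have fullS : row_full S by rewrite /row_full (eqnP freeA); apply/eqP; lia.
pose X := pinvmx S.
have XS : X *m S = 1%:M by exact: mulVpmx.
have SX : S *m X = 1%:M by exact: mulmxVp.
have ST (u1 u2 : 'cV_m) c d : A^T *m u1 + K *m A^T *m u2 + c *: v + d *: (K *m v) =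
    (row_mx (row_mx u1^T u2^T) (row_mx c%:M d%:M) *m S)^T.
  rewrite mul_complex_span !linearD !linearZ /= !trmx_mul !trmxK !mxE eqxx !mulr1n.
  by rewrite mulmxA.
exists A^T, (lsubmx (lsubmx X))^T, (rsubmx (lsubmx X))^T; split=> [z|u1 u2 c d z].
  have zE : z = (row_mx (row_mx (z^T *m lsubmx (lsubmx X)) (z^T *m rsubmx (lsubmx X)))
     (row_mx (z^T *m lsubmx (rsubmx X)) (z^T *m rsubmx (rsubmx X))) *m S)^T.
    by rewrite -!mul_mx_row !hsubmxK -mulmxA XS mulmx1 trmxK.
  exists ((z^T *m lsubmx (rsubmx X)) 0 0), ((z^T *m rsubmx (rsubmx X)) 0 0).
  by rewrite {1}zE ST -!mx11_scalar !trmx_mul !trmxK.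
have zE : z^T *m X = row_mx (row_mx u1^T u2^T) (row_mx c%:M d%:M).
  by rewrite /z ST trmxK -mulmxA SX mulmx1.
rewrite -[z]trmxK -!trmx_mul !mulmx_lsub !mulmx_rsub !mulmx_lsub zE.
by rewrite !row_mxKl row_mxKr !trmxK.
Qed.

(** * The Euclidean inner product *)

Section Dot.
Context {R : realType} {n : nat}.
Implicit Types x y z : 'cV[R]_n.

Lemma dotE x y : dot x y = (x^T *m y) 0 0.
Proof. by rewrite mxE; apply: eq_bigr => i _; rewrite mxE. Qed.

Lemma dotC x y : dot x y = dot y x.
Proof. by apply: eq_bigr => i _; rewrite mulrC. Qed.

Lemma dotDl x y z : dot (x + y) z = dot x z + dot y z.
Proof. by rewrite !dotE linearD mulmxDl mxE. Qed.

Lemma dotZl c x y : dot (c *: x) y = c * dot x y.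
Proof. by rewrite !dotE linearZ -scalemxAl mxE. Qed.

Lemma dotDr x y z : dot z (x + y) = dot z x + dot z y.
Proof. by rewrite dotC dotDl !(dotC z). Qed.

Lemma dotZr c x y : dot x (c *: y) = c * dot x y.
Proof. by rewrite dotC dotZl dotC. Qed.

Lemma dotNl x y : dot (- x) y = - dot x y.
Proof. by rewrite -scaleN1r dotZl mulN1r. Qed.

Lemma dotNr x y : dot x (- y) = - dot x y.
Proof. by rewrite dotC dotNl dotC. Qed.

Lemma dot_mulmxl (A : 'M[R]_n) x y : dot (A *m x) y = dot x (A^T *m y).
Proof. by rewrite !dotE trmx_mul mulmxA. Qed.

Lemma dot_ge0 x : 0 <= dot x x.
Proof. by apply: sumr_ge0 => i _; rewrite -expr2 sqr_ge0. Qed.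

Lemma dot_gt0 x : (0 < dot x x) = (x != 0).
Proof.
rewrite lt0r dot_ge0 andbT; congr (~~ _); rewrite psumr_eq0; last first.
  by move=> i _; rewrite -expr2 sqr_ge0.
apply/allP/eqP => [x0|-> i _]; last by rewrite /= !mxE mulr0 eqxx.
apply/colP => i; rewrite mxE; apply/eqP.
by move/(_ i (mem_index_enum _)): x0 => /=; rewrite -expr2 sqrf_eq0.
Qed.

Lemma dot_is_bilinear :
  bilinear_for (GRing.Scale.Law.clone _ _ *:%R _) (GRing.Scale.Law.clone _ _ *:%R _)
    (@dot R n).
Proof.
split=> [y|y] a x z /=; first by rewrite dotDl dotZl.
by rewrite dotDr dotZr.
Qed.
HB.instance Definition _ := bilinear_isBilinear.Build R _ _ R _ _
  (@dot R n) dot_is_bilinear.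

Lemma dot_continuous : continuous (fun p : 'cV[R]_n * 'cV[R]_n => dot p.1 p.2).
Proof.
rewrite /dot; elim: (index_enum _) => [|i s IHs] p.
  by under eq_fun do rewrite big_nil; exact: cvg_cst.
under eq_fun do rewrite big_cons.
apply: cvgD; last exact: IHs.
apply: cvgM.
  by apply: (@continuous_comp _ _ _ fst (fun x : 'cV[R]_n => x i 0));
    [exact: cvg_fst|exact: coord_continuous].
by apply: (@continuous_comp _ _ _ snd (fun x : 'cV[R]_n => x i 0));
  [exact: cvg_snd|exact: coord_continuous].
Qed.

End Dot.

(** * Differentials of linear maps and of the usual combinations *)

Section LinearContinuity.
Context {R : realType}.
Implicit Types V W : normedModType R.

Lemma scale_mulE (a b : R) : a *: b = a * b. Proof. by []. Qed.

Lemma mulmx_continuous m n (A : 'M[R]_(m, n)) :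
  continuous (mulmx A : 'cV[R]_n -> 'cV[R]_m).
Proof.
apply: bounded_linear_continuous; apply/linear_boundedP.
exists (\sum_i \sum_j `|A i j|); split; first exact: num_real.
move=> r Ar x; apply: mx_norm_le => [|i j].
  by rewrite mulr_ge0// (le_trans _ (ltW Ar))// sumr_ge0// => i _; exact: sumr_ge0.
apply: le_trans (_ : (\sum_i \sum_j `|A i j|) * `|x| <= _); last first.
  by rewrite ler_wpM2r// ltW.
rewrite mxE; apply: le_trans (ler_norm_sum _ _ _) _.
rewrite (bigD1 i)//= mulrDl -[leLHS]addr0 lerD//; last first.
  by rewrite mulr_ge0// sumr_ge0// => k _; exact: sumr_ge0.
rewrite mulr_suml; apply: ler_sum => k _; rewrite normrM ler_wpM2l//.
exact: le_mx_norm.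
Qed.

Lemma fst_continuous V W : continuous (@fst V W).
Proof. by move=> p; exact: cvg_fst. Qed.

Lemma snd_continuous V W : continuous (@snd V W).
Proof. by move=> p; exact: cvg_snd. Qed.

Lemma is_diff_linear V W (L : {linear V -> W}) x : continuous L -> is_diff x L L.
Proof. by move=> Lc; apply: DiffDef; [exact: linear_differentiable|exact: diff_lin]. Qed.

Lemma is_diff_mulmx V m n (A : 'M[R]_(m, n)) (f df : V -> 'cV[R]_n) x :
  is_diff x f df -> is_diff x (fun y => A *m f y) (fun v => A *m df v).
Proof.
move=> fx; exact: is_diff_comp fx (is_diff_linear (L := mulmx A) _ (@mulmx_continuous _ _ A)).
Qed.

Lemma Ck_on_mulmx k V m n (A : 'M[R]_(m, n)) (U : set V) (f : V -> 'cV[R]_n) :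
  open U -> Ck_on k U f -> Ck_on k U (fun y => A *m f y).
Proof.
by move=> oU; apply: (Ck_on_comp_linear (L := mulmx A)) => //; exact: mulmx_continuous.
Qed.

Lemma is_diff_fst V W (p : V * W) : is_diff p fst fst.
Proof. exact: (@is_diff_linear _ _ fst p (@fst_continuous V W)). Qed.

Lemma is_diff_snd V W (p : V * W) : is_diff p snd snd.
Proof. exact: (@is_diff_linear _ _ snd p (@snd_continuous V W)). Qed.

Lemma Ck_on_fst k V W (U : set (V * W)) : Ck_on k U fst.
Proof. exact: (@Ck_on_linear _ k _ _ U fst (@fst_continuous V W)). Qed.

Lemma Ck_on_snd k V W (U : set (V * W)) : Ck_on k U snd.
Proof. exact: (@Ck_on_linear _ k _ _ U snd (@snd_continuous V W)). Qed.

Lemma Ck_on_comp_fst k (Z : normedModType R) V W (U : set Z) (f : Z -> V * W) :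
  open U -> Ck_on k U f -> Ck_on k U (fun u => (f u).1).
Proof. by move=> oU; exact: (@Ck_on_comp_linear _ k _ _ _ U f fst oU (@fst_continuous V W)). Qed.

Lemma Ck_on_comp_snd k (Z : normedModType R) V W (U : set Z) (f : Z -> V * W) :
  open U -> Ck_on k U f -> Ck_on k U (fun u => (f u).2).
Proof. by move=> oU; exact: (@Ck_on_comp_linear _ k _ _ _ U f snd oU (@snd_continuous V W)). Qed.

Lemma is_diff_comp1 V (f df : V -> R) (phi : R -> R) x d :
  is_diff x f df -> is_derive (f x) 1 phi d ->
  is_diff x (fun y => phi (f y)) (fun v => df v * d).
Proof.
move=> fx [px dpx]; have dp : is_diff (f x) phi ( *:%R^~ d).
  by apply: DiffDef; [exact/derivable1_diffP|rewrite deriv1E// derive1E dpx].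
exact: (is_diff_comp fx dp).
Qed.

Lemma is_diff_mul V (f df g dg : V -> R) x :
  is_diff x f df -> is_diff x g dg ->
  is_diff x (fun y => f y * g y) (fun v => df v * g x + f x * dg v).
Proof. exact: (is_diff_bilinear (B := @GRing.mul R) (@mul_continuous R)). Qed.

Lemma is_diff_dot V n (f df g dg : V -> 'cV[R]_n) x :
  is_diff x f df -> is_diff x g dg ->
  is_diff x (fun y => dot (f y) (g y)) (fun v => dot (df v) (g x) + dot (f x) (dg v)).
Proof. exact: (is_diff_bilinear (B := @dot R n) (@dot_continuous R n)). Qed.

Lemma Ck_on_dot k V n (U : set V) (f g : V -> 'cV[R]_n) :
  open U -> Ck_on k U f -> Ck_on k U g -> Ck_on k U (fun x => dot (f x) (g x)).
Proof. exact: (Ck_on_bilinear (B := @dot R n) (@dot_continuous R n)). Qed.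

(** Used in [tangentP] to linearise the equations that a curve satisfies. *)
Lemma is_diff_locally_cst (V W : normedModType R) (f : V -> W) df x (U : set V) c :
  open U -> U x -> (forall y, U y -> f y = c) -> is_diff x f df -> forall v, df v = 0.
Proof.
move=> oU Ux fc dfx v; rewrite -(derive_diff v dfx) (near_eq_derive (g := cst c)).
  by rewrite derive_cst.
by apply: filterS (open_nbhs_nbhs (conj oU Ux)) => y /fc.
Qed.

Lemma open_sym_itv (e : R) : open [set t : R | - e < t < e].
Proof.
rewrite (_ : mkset _ = [set t | - e < t] `&` [set t | t < e]).
  by apply: openI; [exact: open_gt|exact: open_lt].
by apply/seteqP; split=> t /= /andP.
Qed.

End LinearContinuity.

(** * The null cone *)

(* [K] is an orthogonal complex structure, [Q] a real structure for it. *)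
Definition real_structure (R : realType) n (Q K : 'M[R]_n) : Prop :=
  [/\ Q^T = Q, K^T = - K, Q *m Q = 1%:M, K *m K = - 1%:M & Q *m K = - (K *m Q)].

Section NullCone.
Context {R : realType} {n : nat} (Q K : 'M[R]_n).
Hypothesis QK_real : real_structure Q K.
Let QT : Q^T = Q. Proof. by case: QK_real. Qed.
Let KT : K^T = - K. Proof. by case: QK_real. Qed.
Let QQ : Q *m Q = 1%:M. Proof. by case: QK_real. Qed.
Let KK : K *m K = - 1%:M. Proof. by case: QK_real. Qed.
Let QK : Q *m K = - (K *m Q). Proof. by case: QK_real. Qed.
Implicit Types x y z e w : 'cV[R]_n.

Lemma QQv x : Q *m (Q *m x) = x.
Proof. by rewrite mulmxA QQ mul1mx. Qed.

Lemma KKv x : K *m (K *m x) = - x.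
Proof. by rewrite mulmxA KK mulNmx mul1mx. Qed.

Lemma QKv x : Q *m (K *m x) = - (K *m (Q *m x)).
Proof. by rewrite !mulmxA QK mulNmx. Qed.

Lemma dotQ x y : dot (Q *m x) y = dot x (Q *m y).
Proof. by rewrite dot_mulmxl QT. Qed.

Lemma dotK x y : dot (K *m x) y = - dot x (K *m y).
Proof. by rewrite dot_mulmxl KT mulNmx dotNr. Qed.

Lemma dotKK x y : dot (K *m x) (K *m y) = dot x y.
Proof. by rewrite dotK KKv dotNr opprK. Qed.

Lemma dotKv x y : dot x (K *m y) = - dot y (K *m x).
Proof. by rewrite dotC dotK. Qed.

Lemma dotxK x : dot x (K *m x) = 0.
Proof. by have := dotKv x x; lra. Qed.

Let expand := (@mulmxDr R n n 1 Q, @mulmxDr R n n 1 K, @mulmxN R n n 1 Q, @mulmxN R n n 1 K,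
  =^~ @scalemxAr R n n 1, @dotDl R n, @dotDr R n, @dotZl R n, @dotZr R n,
  @dotNl R n, @dotNr R n, QQv, KKv, QKv, dotQ, dotK).

(* With [i] acting as [K], the real and imaginary parts of the complex bilinear
   form [b] whose real part is [dot (Q z) w]; the cone is [b z z = 0]. *)
Definition bre z w := dot (Q *m z) w.
Definition bim z w := - dot (Q *m (K *m z)) w.
Definition null z := bre z z = 0 /\ bim z z = 0.

(* The real and imaginary parts of [- b e e / (2 b e (Q x))]; note that
   [b e (Q x) = dot e x + i dot e (K x)]. *)
Definition stereo_t0 x e :=
  - (bre e e * dot e x + bim e e * dot e (K *m x)) *
  (2 * (dot e x * dot e x + dot e (K *m x) * dot e (K *m x)))^-1.
Definition stereo_t1 x e :=
  - (bim e e * dot e x - bre e e * dot e (K *m x)) *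
  (2 * (dot e x * dot e x + dot e (K *m x) * dot e (K *m x)))^-1.
Definition admissible x e : Prop :=
  dot e x * dot e x + dot e (K *m x) * dot e (K *m x) != 0.

(* The point of the cone on the complex line through [e] directed by the null
   vector [Q x]. *)
Definition stereo x e := e + stereo_t0 x e *: (Q *m x) + stereo_t1 x e *: (K *m (Q *m x)).

Section Shift.
Context (x : 'cV[R]_n) (nx : null x).

Let x0 : dot x (Q *m x) = 0.
Proof. by move: nx.1; rewrite /bre dotQ. Qed.
Let x1 : dot x (K *m (Q *m x)) = 0.
Proof. by move: nx.2; rewrite /bim QKv dotNl dotK dotQ QKv dotNr !opprK. Qed.

(** b(e, Q x) is constant along the line because [Q x] is null. *)
Lemma shift_dot e c d : let z := e + c *: (Q *m x) + d *: (K *m (Q *m x)) in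
  dot z x = dot e x /\ dot z (K *m x) = dot e (K *m x).
Proof.
by rewrite /=; split; rewrite !expand ?x0 ?x1; ring.
Qed.

(** Since [Q x] is null, the quadratic form is affine along the line: meeting the cone is a linear
    equation in c + i d. *)
Lemma shift_bil e c d : let z := e + c *: (Q *m x) + d *: (K *m (Q *m x)) in
  bre z z = bre e e + 2 * (c * dot e x - d * dot e (K *m x)) /\
  bim z z = bim e e + 2 * (c * dot e (K *m x) + d * dot e x).
Proof.
rewrite /= /bre /bim; split; rewrite !expand ?x0 ?x1 ?dotxK (dotKv x e) (dotC x e); ring.
Qed.

Lemma stereo_null e : admissible x e -> null (stereo x e).
Proof.
rewrite /admissible => ae; have [h0 h1] := shift_bil e (stereo_t0 x e) (stereo_t1 x e).
split; rewrite /stereo ?h0 ?h1 /stereo_t0 /stereo_t1.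
  by field.
by field.
Qed.

Lemma stereo_dot e : dot (stereo x e) x = dot e x /\ dot (stereo x e) (K *m x) = dot e (K *m x).
Proof. exact: shift_dot. Qed.

(** Admissibility says that the slope of this linear equation is nonzero, so its solution is
    unique. *)
Lemma stereo_shift e c d : admissible x e ->
  null (e + c *: (Q *m x) + d *: (K *m (Q *m x))) ->
  stereo x e = e + c *: (Q *m x) + d *: (K *m (Q *m x)).
Proof.
rewrite /admissible => ae [nz0 nz1]; have [] := shift_bil e c d; rewrite {}nz0 {}nz1 /stereo.
move=> /esym/eqP; rewrite addr_eq0 => /eqP h0 /esym/eqP; rewrite addr_eq0 => /eqP h1.
have -> : stereo_t0 x e = c by rewrite /stereo_t0 h0 h1; field.
by have -> : stereo_t1 x e = d by rewrite /stereo_t1 h0 h1; field.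
Qed.

(* The complex line directed by [Q x] is transverse to the cone. *)
Lemma tangent_shift_eq0 z c d : admissible x z ->
  let w := c *: (Q *m x) + d *: (K *m (Q *m x)) in
  bre z w = 0 -> bim z w = 0 -> w = 0.
Proof.
rewrite /admissible /bre /bim /= => az; rewrite !expand => h0 h1.
(* b(z, w) is the product of c + i d and b(z, Q x), and the squared modulus is multiplicative. *)
have cd : (c ^+ 2 + d ^+ 2) *
    (dot z x * dot z x + dot z (K *m x) * dot z (K *m x)) = 0.
  rewrite (_ : _ * _ = (c * dot z x + d * - dot z (K *m x)) ^+ 2 +
    (c * dot z (K *m x) + d * dot z x) ^+ 2); last by ring.
  by rewrite h0 (_ : _ + _ * dot z x = 0) ?expr0n ?addr0//; lra.
move/eqP: cd; rewrite mulf_eq0 (negbTE az) orbF paddr_eq0 ?sqr_ge0// !sqrf_eq0.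
by case/andP => /eqP -> /eqP ->; rewrite !scale0r addr0.
Qed.

End Shift.

(** With [bim_mulK], this reads b(z, K w) = i b(z, w). *)
Lemma bre_mulK z w : bre z (K *m w) = - bim z w.
Proof. by rewrite /bre /bim !expand; ring. Qed.

Lemma bim_mulK z w : bim z (K *m w) = bre z w.
Proof. by rewrite /bre /bim !expand; ring. Qed.

Lemma breB z w w' : bre z (w - w') = bre z w - bre z w'.
Proof. by rewrite /bre dotDr dotNr. Qed.

Lemma bimB z w w' : bim z (w - w') = bim z w - bim z w'.
Proof. by rewrite /bim dotDr dotNr opprD. Qed.

Lemma breC z w : bre z w = bre w z.
Proof. by rewrite /bre dotQ dotC. Qed.

Lemma bimC z w : bim z w = bim w z.
Proof. by rewrite /bim (dotC (Q *m (K *m w))) !expand; ring. Qed.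

(** * The differential of the projection onto the cone *)

Section StereoCalculus.
Variable x : 'cV[R]_n.

Lemma Ck_on_stereo_t k (V : normedModType R) (U : set V) (e : V -> 'cV[R]_n) :
  open U -> (forall u, U u -> admissible x (e u)) -> Ck_on k U e ->
  Ck_on k U (fun u => stereo_t0 x (e u)) /\ Ck_on k U (fun u => stereo_t1 x (e u)).
Proof.
move=> oU ae ce; have cx c : Ck_on k U (fun=> c : 'cV[R]_n) by exact: Ck_on_cst.
have d0 := Ck_on_dot oU ce (cx x); have d1 := Ck_on_dot oU ce (cx (K *m x)).
have b0 := Ck_on_dot oU (Ck_on_mulmx Q oU ce) ce.
have b1 := Ck_onN oU (Ck_on_dot oU (Ck_on_mulmx Q oU (Ck_on_mulmx K oU ce)) ce).
have dD := Ck_onM oU (Ck_on_cst k U (2 : R)) (Ck_onD oU (Ck_onM oU d0 d0) (Ck_onM oU d1 d1)).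
have dV := Ck_on_comp1 oU _ (Ck_on_inv k) dD.
split; (apply: Ck_onM => //; last first);
  try by apply: dV => u Uu /=; rewrite mulf_neq0 ?pnatr_eq0//; exact: ae.
- by apply: Ck_onN => //; apply: Ck_onD => //; exact: Ck_onM.
- apply: Ck_onN => //; apply: Ck_onD => //; first exact: Ck_onM.
  by apply: Ck_onN => //; exact: Ck_onM.
Qed.

Lemma Ck_on_stereo k (V : normedModType R) (U : set V) (e : V -> 'cV[R]_n) :
  open U -> (forall u, U u -> admissible x (e u)) -> Ck_on k U e ->
  Ck_on k U (fun u => stereo x (e u)).
Proof.
move=> oU ae ce; have [c0 c1] := Ck_on_stereo_t oU ae ce.
apply: Ck_onD => //; first apply: Ck_onD => //;
  by apply: Ck_on_scale => //; exact: Ck_on_cst.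
Qed.

Lemma open_admissible : open (admissible x).
Proof.
pose f e := dot e x * dot e x + dot e (K *m x) * dot e (K *m x).
rewrite (_ : admissible x = f @^-1` [set t | t != 0]) //.
apply: open_comp => [e _|]; last exact: open_neq0.
have ci := Ck_on_id 0 (@setT 'cV[R]_n).
have cx (c : 'cV[R]_n) : Ck_on 0 (@setT 'cV[R]_n) (fun=> c) by exact: Ck_on_cst.
have d0 := Ck_on_dot openT ci (cx x); have d1 := Ck_on_dot openT ci (cx (K *m x)).
exact: (Ck_onD openT (Ck_onM openT d0 d0) (Ck_onM openT d1 d1)) e I.
Qed.

(** Only the shape of the differential is recorded, the identity plus a vector of the line; the
    derivatives of the rational coefficients need not be computed. *)
Lemma diff_stereo e : admissible x e -> differentiable (stereo x) e /\
  forall w, exists c d,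
    'd (stereo x) e w = w + c *: (Q *m x) + d *: (K *m (Q *m x)).
Proof.
move=> ae; have oA := open_admissible.
have [] := @Ck_on_stereo_t 1 _ _ id oA (fun _ => id) (Ck_on_id 1 _).
move=> /Ck_onSE[/(_ e ae)/differentiableP d0 _] /Ck_onSE[/(_ e ae)/differentiableP d1 _].
have ds := is_diffD (is_diffD (is_diff_id e)
  (is_diff_scale d0 (is_diff_cst (Q *m x) e)))
  (is_diff_scale d1 (is_diff_cst (K *m (Q *m x)) e)).
split; first exact: (@ex_diff _ _ _ _ _ _ _ ds).
move=> w; exists ('d (stereo_t0 x) e w), ('d (stereo_t1 x) e w).
rewrite [LHS](congr1 (fun f => f w) (@diff_val _ _ _ _ _ _ _ ds)) !fctE /=.
by rewrite !scaler0 !addr0.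
Qed.

Hypothesis nx : null x.

(** Differentiate the identity b = 0 satisfied by [stereo x] on an open set; by symmetry of b the
    result is twice the wanted value. *)
Lemma diff_stereo_tangent e w : admissible x e ->
  bre (stereo x e) ('d (stereo x) e w) = 0 /\ bim (stereo x e) ('d (stereo x) e w) = 0.
Proof.
move=> ae; have [/differentiableP ds _] := diff_stereo ae.
have near0 (f : 'cV[R]_n -> R) df : (forall e, admissible x e -> f e = 0) ->
    is_diff e f df -> df w = 0.
  move=> f0 dfe; rewrite -(derive_diff w dfe) (near_eq_derive (g := cst 0)) ?derive_cst//.
  by apply: filterS (open_nbhs_nbhs (conj open_admissible ae)) => y /f0.
have dQ := is_diff_dot (is_diff_mulmx Q ds) ds.
have dK := is_diffN (is_diff_dot (is_diff_mulmx Q (is_diff_mulmx K ds)) ds).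
have /= h0 := near0 _ _ (fun e ae => (stereo_null nx ae).1) dQ.
have /= h1 := near0 _ _ (fun e ae => (stereo_null nx ae).2) dK.
move: h0 h1; rewrite -[dot (Q *m 'd _ _ _) _]/(bre _ _) !fctE -/(bre _ _) opprD -!/(bim _ _).
rewrite (breC ('d _ _ _)) (bimC ('d _ _ _)) -!mulr2n => /eqP + /eqP.
by rewrite !mulrn_eq0 /= => /eqP -> /eqP ->.
Qed.

(** Two candidates differ by a vector of the line that is tangent to the cone, and transversality
    kills it. *)
Lemma diff_stereo_unique e w w' c d : admissible x e ->
  bre (stereo x e) w' = 0 -> bim (stereo x e) w' = 0 ->
  w' = w + c *: (Q *m x) + d *: (K *m (Q *m x)) -> 'd (stereo x) e w = w'.
Proof.
move=> ae r0 i0 w'E; have [_ /(_ w)[c' [d' dE]]] := diff_stereo ae.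
have [r1 i1] := diff_stereo_tangent w ae.
have sE : 'd (stereo x) e w - w' = (c' - c) *: (Q *m x) + (d' - d) *: (K *m (Q *m x)).
  rewrite dE w'E; move: (Q *m x) (K *m _) => v v'.
  by apply/colP => i; rewrite !mxE; ring.
apply/eqP; rewrite -subr_eq0 sE; apply/eqP.
have as' : admissible x (stereo x e).
  by rewrite /admissible; have [-> ->] := stereo_dot nx e.
apply: (tangent_shift_eq0 as'); rewrite -sE.
  by rewrite breB r1 r0 subrr.
by rewrite bimB i1 i0 subrr.
Qed.

Lemma diff_stereoK e w : admissible x e ->
  'd (stereo x) e (K *m w) = K *m 'd (stereo x) e w.
Proof.
move=> ae; have [_ /(_ w)[c [d dE]]] := diff_stereo ae.
have [r0 i0] := diff_stereo_tangent w ae.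
(* i (c + i d) = - d + i c. *)
apply: (diff_stereo_unique (c := - d) (d := c)) => //.
- by rewrite bre_mulK i0 oppr0.
- by rewrite bim_mulK.
- rewrite dE !expand; move: (Q *m x) (K *m _) (K *m w) => v v' w'.
  by apply/colP => i; rewrite !mxE; ring.
Qed.

End StereoCalculus.

End NullCone.

(** * Polar coordinates on the cone *)

Section PolarCoordinates.
Context {R : realType} {n : nat}.
Implicit Types (x y z w : 'cV[R]_n) (a : R * R) (p : (R * R) * 'cV[R]_n) (t : R).

(** The logarithm of the Euclidean norm, which [normalize] turns into an angle on the circle. *)
Definition theta z : R := 2^-1 * ln (dot z z).
Definition cis t : R * R := (cos t, sin t).
Definition normalize z : (R * R) * 'cV[R]_n := (cis (theta z), expR (- theta z) *: z).

(** The branch of the argument of [a] centred at [t]; the quotient is the tangent of the argument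
    minus [t]. *)
Definition angle t a : R := t + atan ((a.2 * cos t - a.1 * sin t) * (a.1 * cos t + a.2 * sin t)^-1).
Definition unroll t p : 'cV[R]_n := expR (angle t p.1) *: p.2.
Definition half_plane t : set (R * R) := [set a | 0 < a.1 * cos t + a.2 * sin t].

(** The radial component of [y] becomes a multiple of [epsilon], the rest is tangent to the sphere;
    (s [epsilon], X) |-> s x + X undoes it. *)
Definition polar p y : (R * R) * 'cV[R]_n :=
  (dot p.2 y *: imul p.1, y - dot p.2 y *: p.2).

Lemma expR_theta z : z != 0 -> expR (theta z) * expR (theta z) = dot z z.
Proof.
move=> z0; rewrite -expRD (_ : _ + _ = ln (dot z z)) ?lnK ?posrE ?dot_gt0//.
by rewrite /theta; field.
Qed.

Lemma dot_normalize z : z != 0 -> dot (normalize z).2 (normalize z).2 = 1.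
Proof.
move=> z0; rewrite /= dotZl dotZr -(expR_theta z0) expRN.
by have := expR_gt0 (theta z); move: (expR _) => r /lt0r_neq0 r0; field.
Qed.

Lemma circle_cis t : circle (cis t).
Proof. exact: cos2Dsin2. Qed.

Lemma is_diff_normalize z : z != 0 ->
  is_diff z normalize (fun w => polar (normalize z) (expR (- theta z) *: w)).
Proof.
move=> z0; have zz : 0 < dot z z by rewrite dot_gt0.
have dzz := is_diff_dot (is_diff_id z) (is_diff_id z).
have dln := is_diff_comp1 dzz (is_derive1_ln zz).
have dt : is_diff z theta (fun w => dot z w / dot z z).
  apply: is_diff_eq (is_diff_scale (is_diff_cst (2^-1 : R) z) dln) _.
  apply/funext => w; rewrite !fctE /= scale0r add0r (dotC w).
  rewrite -[_ *: _]/(_ * _); field.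
  by rewrite lt0r_neq0.
have dc := is_diff_comp1 dt (is_derive_cos (theta z)).
have ds := is_diff_comp1 dt (is_derive_sin (theta z)).
have de := is_diff_comp1 (is_diffN dt) (is_derive_expR (- theta z)).
have dn := is_diff_pair (is_diff_pair dc ds) (is_diff_scale de (is_diff_id z)).
apply: is_diff_eq dn _; apply/funext => w; rewrite /polar /= dotZl dotZr.
have -> : expR (- theta z) * (expR (- theta z) * dot z w) = dot z w / dot z z.
  rewrite -(expR_theta z0) expRN.
  by have := expR_gt0 (theta z); move: (expR _) => r /lt0r_neq0 r0; field.
rewrite !fctE /imul /=; congr (_, _).
by rewrite mulNr scaleNr scalerA addrC.
Qed.

Lemma Ck_on_theta k (V : normedModType R) (U : set V) (f : V -> 'cV[R]_n) :
  open U -> (forall u, U u -> f u != 0) -> Ck_on k U f -> Ck_on k U (fun u => theta (f u)).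
Proof.
move=> oU f0 cf; apply: Ck_onM => //; first exact: Ck_on_cst.
apply: (Ck_on_comp1 oU _ (Ck_on_ln k)); last exact: Ck_on_dot.
by move=> u Uu /=; rewrite dot_gt0 f0.
Qed.

Lemma Ck_on_normalize k (V : normedModType R) (U : set V) (f : V -> 'cV[R]_n) :
  open U -> (forall u, U u -> f u != 0) -> Ck_on k U f ->
  Ck_on k U (fun u => normalize (f u)).
Proof.
move=> oU f0 cf; have ct := Ck_on_theta oU f0 cf; have [cc cs] := @Ck_on_cos_sin R k.
apply: Ck_on_pair => //; first apply: Ck_on_pair => //.
- exact: (Ck_on_comp1 oU _ cc).
- exact: (Ck_on_comp1 oU _ cs).
- apply: Ck_on_scale => //.
  by apply: (Ck_on_comp1 oU _ (@Cinf_expR R k)) => //; exact: Ck_onN.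
Qed.

Lemma open_half_plane t : open (fst @^-1` half_plane t : set ((R * R) * 'cV[R]_n)).
Proof.
pose f (p : (R * R) * 'cV[R]_n) := p.1.1 * cos t + p.1.2 * sin t.
rewrite (_ : _ @^-1` _ = f @^-1` [set r | 0 < r])//.
apply: open_comp => [p _|]; last exact: open_gt.
have cf := Ck_on_fst 0 (@setT ((R * R) * 'cV[R]_n)).
have c1 := Ck_on_comp_fst openT cf; have c2 := Ck_on_comp_snd openT cf.
exact: (Ck_onD openT (Ck_onM openT c1 (Ck_on_cst _ _ (cos t)))
  (Ck_onM openT c2 (Ck_on_cst _ _ (sin t)))) p I.
Qed.

Lemma Ck_on_unroll k t : Ck_on k (fst @^-1` half_plane t) (unroll t).
Proof.
set U := _ @^-1` _; have oU : open U := @open_half_plane t.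
have cf := Ck_on_fst k U; have c1 := Ck_on_comp_fst oU cf; have c2 := Ck_on_comp_snd oU cf.
have cc := Ck_on_cst k U (cos t); have cs := Ck_on_cst k U (sin t).
apply: Ck_on_scale => //; last exact: Ck_on_snd.
apply: (Ck_on_comp1 oU _ (@Cinf_expR R k)) => //.
apply: Ck_onD => //; first exact: Ck_on_cst.
apply: (Ck_on_comp1 oU _ (@Cinf_atan R k)) => //; apply: Ck_onM => //.
  by apply: Ck_onD => //; [|apply: Ck_onN => //]; exact: Ck_onM.
apply: (Ck_on_comp1 oU _ (Ck_on_inv k)) => [p /lt0r_neq0//|].
by apply: Ck_onD => //; exact: Ck_onM.
Qed.

(** The argument grows at rate [s] along [s *: imul a], so up to the factor e^angle this
    differential is the inverse of [polar]. *)
Lemma diff_unroll t p : half_plane t p.1 -> differentiable (unroll t) p /\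
  forall s X, 'd (unroll t) p (s *: imul p.1, X) =
    expR (angle t p.1) *: (s *: p.2 + X).
Proof.
move=> hp.
have d1 : is_diff p (fun q : (R * R) * 'cV[R]_n => q.1.1) (fun v => v.1.1).
  exact: (is_diff_comp (is_diff_fst p) (is_diff_fst p.1)).
have d2 : is_diff p (fun q : (R * R) * 'cV[R]_n => q.1.2) (fun v => v.1.2).
  exact: (is_diff_comp (is_diff_fst p) (is_diff_snd p.1)).
have cs r : is_diff p (cst r : _ -> R) (fun=> 0) := is_diff_cst r p.
have dc := is_diffD (is_diff_mul d1 (cs (cos t))) (is_diff_mul d2 (cs (sin t))).
have ds := is_diffB (is_diff_mul d2 (cs (cos t))) (is_diff_mul d1 (cs (sin t))).
have c0 : p.1.1 * cos t + p.1.2 * sin t != 0 by exact: lt0r_neq0.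
have dV := is_diff_comp1 dc (is_deriveV (f := id) c0 (is_derive_id _ _)).
have da := is_diff_comp1 (is_diff_mul ds dV) (is_derive1_atan _).
have de := is_diff_comp1 (is_diffD (cs t) da) (is_derive_expR _).
have du := is_diff_scale de (is_diff_snd p).
split; first exact: (@ex_diff _ _ _ _ _ _ _ du).
move=> s X; rewrite [LHS](congr1 (fun f => f _) (@diff_val _ _ _ _ _ _ _ du)).
rewrite !fctE /= scalerDr scalerA; congr (_ *: _ + _).
rewrite mulrC; congr (_ * _); rewrite !mulr0 !addr0 add0r -[_ *: 1]/(_ * 1).
move: c0; move: (p.1.1) (p.1.2) (cos t) (sin t) => a1 a2 c' s' c0.
have sZ (r : R) : s *: r = s * r by [].
(* C + i S is [a] rotated by - t; along [s *: imul a] its derivative is s i (C + i S). *)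
rewrite !sZ; set C := a1 * c' + a2 * s' in c0 *; set S := a2 * c' - a1 * s'.
have -> : s * a1 * c' - s * - a2 * s' = s * C by rewrite /C; ring.
have -> : s * - a2 * c' + s * a1 * s' = - (s * S) by rewrite /S; ring.
have CS : C ^+ 2 + S ^+ 2 != 0 by rewrite paddr_eq0 ?sqr_ge0// !sqrf_eq0 negb_and c0.
by field; rewrite c0 /= -?expr2 CS.
Qed.

Lemma unroll_normalize t z : z != 0 -> - (pi / 2) < theta z - t < pi / 2 ->
  unroll t (normalize z) = z.
Proof.
move=> z0 zt; rewrite /unroll /normalize /= scalerA -expRD.
suff -> : angle t (cis (theta z)) = theta z by rewrite subrr expR0 scale1r.
rewrite /angle /= -cosB -sinB (_ : _ * _^-1 = tan (theta z - t)) ?tanK ?in_itv//.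
by rewrite addrC subrK.
Qed.

Lemma cos_sin_atan (c s : R) : 0 < c -> c ^+ 2 + s ^+ 2 = 1 ->
  cos (atan (s * c^-1)) = c /\ sin (atan (s * c^-1)) = s.
Proof.
move=> c0 cs1; set r := atan _.
have cr : 0 < cos r by apply: cos_gt0_pihalf; rewrite atan_gtNpi2 atan_ltpi2.
have tr : sin r = s * c^-1 * cos r.
  by rewrite -[s * c^-1]atanK -/r /tan mulfVK// lt0r_neq0.
have cE : cos r = c.
  (* [cos r] and [c] are both positive, so their squares may be compared. *)
  apply/eqP; rewrite -(eqrXn2 (n := 2)) ?ltW//; apply/eqP.
  have := cos2Dsin2 r; rewrite tr => h.
  have : cos r ^+ 2 * (c ^+ 2 + s ^+ 2) = c ^+ 2.
    by rewrite -[RHS]mulr1 -h; field; exact: lt0r_neq0.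
  by rewrite cs1 mulr1.
by rewrite tr cE mulfVK ?lt0r_neq0.
Qed.

Lemma normalize_unroll t a x : circle a -> half_plane t a -> dot x x = 1 ->
  normalize (unroll t (a, x)) = (a, x) /\
  - (pi / 2) < theta (unroll t (a, x)) - t < pi / 2.
Proof.
case: a => a1 a2; rewrite /circle /half_plane /= => ca hp x1.
have tE : theta (unroll t (a1, a2, x)) = angle t (a1, a2).
  rewrite /theta /unroll /= dotZl dotZr x1 mulr1 -expRD expRK.
  by field.
split; last first.
  by rewrite tE /angle addrAC subrr add0r atan_gtNpi2 atan_ltpi2.
rewrite /normalize tE /unroll /= scalerA -expRD addNr expR0 scale1r; congr (_, _).
have [||cE sE] := @cos_sin_atan (a1 * cos t + a2 * sin t) (a2 * cos t - a1 * sin t).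
- exact: hp.
- rewrite -[RHS]ca -[RHS]mulr1 -(cos2Dsin2 t); ring.
rewrite /cis /angle cosD sinD /= cE sE -[a1 in RHS]mulr1 -[a2 in RHS]mulr1 -(cos2Dsin2 t).
by congr (_, _); ring.
Qed.

End PolarCoordinates.

(** * The almost complex structure *)

Section Focal.
Context {R : realType} {l : nat} (P : 'I_2 -> 'M[R]_(2 * l)).
Hypothesis HP : symmetric_clifford_system P.
Implicit Types (a : R * R) (x y z X : 'cV[R]_(2 * l)).

Local Notation Q := (P 0).
Local Notation K := (P 0 *m P 1).

Lemma clifford_anticomm : P 0 *m P 1 = - (P 1 *m P 0).
Proof.
have := HP.2 0 1; rewrite mulr0 -[_%:M]scalemx1 scale0r => /eqP.
by rewrite addr_eq0 => /eqP.
Qed.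

Let QT : Q^T = Q. Proof. exact: HP.1. Qed.
Let KT : K^T = - K.
Proof. by rewrite trmx_mul !(HP.1) [in RHS]clifford_anticomm opprK. Qed.
Let QQ : Q *m Q = 1%:M. Proof. exact: clifford_sqr. Qed.
Let QKE : Q *m K = P 1. Proof. by rewrite mulmxA QQ mul1mx. Qed.
Let QK : Q *m K = - (K *m Q).
Proof. by rewrite QKE clifford_anticomm mulNmx opprK -mulmxA QQ mulmx1. Qed.
Let KK : K *m K = - 1%:M.
Proof.
rewrite [X in X *m _]clifford_anticomm mulNmx -mulmxA [P 0 *m (_ *m _)]mulmxA QQ mul1mx.
by rewrite clifford_sqr.
Qed.

Lemma clifford_real_structure : real_structure Q K. Proof. by []. Qed.
Let HQK := clifford_real_structure.

(** As [P 0 *m K = P 1], the two quadratic equations of M+ are, up to sign, the real and imaginary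
    parts of b(x, x) = 0. *)
Lemma MplusE x : Mplus P x <-> dot x x = 1 /\ null Q K x.
Proof.
rewrite /Mplus /null /bre /bim mulmxA QKE /=; split=> [[-> -> ->]|[-> [-> /eqP]]].
  by rewrite oppr0.
by rewrite oppr_eq0 => /eqP ->.
Qed.

Lemma null_scale c x : null Q K x -> null Q K (c *: x).
Proof.
case=> h0 h1; split; first by rewrite /bre -scalemxAr dotZl dotZr -/(bre _ _ _) h0 !mulr0.
move/eqP: h1; rewrite /bim oppr_eq0 => /eqP h1.
by rewrite -!scalemxAr dotZl dotZr h1 !mulr0 oppr0.
Qed.

Lemma admissible_neq0 x e : admissible K x e -> e != 0.
Proof.
apply: contraTneq => ->; rewrite /admissible.
by rewrite -(scale0r x) !dotZl !mul0r addr0 eqxx.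
Qed.

Lemma admissible_scale x e (c : R) : c != 0 -> admissible K x e -> admissible K x (c *: e).
Proof.
rewrite /admissible !dotZl => c0 ae.
rewrite (_ : _ + _ = c ^+ 2 * (dot e x * dot e x + dot e (K *m x) * dot e (K *m x))).
  by rewrite mulf_neq0// sqrf_eq0.
by ring.
Qed.

Lemma admissible_unit x e : dot e x = 1 -> admissible K x e.
Proof. by move=> ex; rewrite /admissible ex lt0r_neq0// ltr_pwDl// -expr2 sqr_ge0. Qed.

(** The affine line x + t X is projected onto the cone and normalised. This explicit curve replaces
    the implicit function theorem. *)
Lemma focal_curve x X : Mplus P x -> dot X x = 0 -> bre Q x X = 0 -> bim Q K x X = 0 ->
  exists g : R -> 'cV[R]_(2 * l), [/\ Cinf_on setT g, forall t, Mplus P (g t),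
    g 0 = x & is_diff (0 : R) g (fun t => t *: X)].
Proof.
move=> /MplusE[x1 nx] Xx r0 i0; pose e t := x + t *: X.
have ex t : dot (e t) x = 1 by rewrite dotDl dotZl Xx mulr0 addr0.
have ae t : admissible K x (e t) by exact: admissible_unit.
pose z t := stereo Q K x (e t).
have z0 t : z t != 0.
  apply: (@admissible_neq0 x); apply: admissible_unit.
  by have [-> _] := stereo_dot HQK nx (e t).
have e0 : e 0 = x by rewrite /e scale0r addr0.
have zx : stereo Q K x x = x.
  (* [x] already lies on the cone, so its shift is 0. *)
  have h := stereo_shift HQK (x := x) nx (e := x) (c := 0) (d := 0).
  by rewrite h ?scale0r ?addr0//; exact: admissible_unit.
have tx : theta x = 0 by rewrite /theta x1 ln1 mulr0.
exists (fun t => (normalize (z t)).2); split.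
- move=> k; apply: (Ck_on_comp_snd openT); apply: (Ck_on_normalize openT) => //.
  apply: (Ck_on_stereo Q openT) => //; apply: (Ck_onD openT); first exact: Ck_on_cst.
  by apply: (Ck_on_scale openT); [exact: Ck_on_id|exact: Ck_on_cst].
- move=> t; apply/MplusE; split; first exact: dot_normalize.
  exact/null_scale/(stereo_null HQK nx).
- by rewrite /z e0 zx /= tx oppr0 expR0 scale1r.
- have de : is_diff (0 : R) e (fun t => t *: X).
    by apply: is_diff_eq (is_diffD (is_diff_cst x _) (is_diff_scalel (0 : R) X)) _;
      apply/funext => t; rewrite !fctE add0r.
  have ds := differentiableP (diff_stereo Q (ae 0)).1.
  have dn := is_diff_normalize (z0 0).
  (* [X] is tangent to the cone at [x], hence is its own projection, with zero shift. *)
  have dX : 'd (stereo Q K x) x X = X.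
    apply: (diff_stereo_unique HQK nx (c := 0) (d := 0)); rewrite ?zx//.
    - exact: admissible_unit.
    - by rewrite !scale0r !addr0.
  have := is_diff_comp (is_diff_comp (is_diff_comp de ds) dn) (is_diff_snd _).
  move/is_diff_eq; apply; apply/funext => t /=.
  have dtX : 'd (stereo Q K x) x (t *: X) = t *: X.
    by rewrite -[in RHS]dX; exact: linearZ.
  by rewrite /z e0 zx tx oppr0 expR0 !scale1r dtX dotZr dotC Xx mulr0 scale0r subr0.
Qed.

Lemma tangent_focal x X : Mplus P x -> dot X x = 0 -> bre Q x X = 0 ->
  bim Q K x X = 0 -> tangent (Mplus P) x X.
Proof.
move=> Mx Xx r0 i0; have [g [cg Mg g0 dg]] := focal_curve Mx Xx r0 i0.
exists 1 => //; exists g; split=> //; first by move=> k; exact: Ck_on_sub (cg k).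
by rewrite derive1E (derive_diff _ dg) scale1r.
Qed.

Lemma tangent_circle_Mplus a x s X : circle a -> Mplus P x -> dot X x = 0 ->
  bre Q x X = 0 -> bim Q K x X = 0 ->
  tangent (circle_Mplus P) (a, x) (s *: imul a, X).
Proof.
move=> ca Mx Xx r0 i0; have [g [cg Mg g0 dg]] := focal_curve Mx Xx r0 i0.
pose r (t : R) : R * R := cos (t * s) *: a + sin (t * s) *: imul a.
exists 1 => //; exists (fun t => (r t, g t)); split.
- move=> k; apply: (@Ck_on_sub _ _ _ _ setT) => //.
  have cs : Ck_on k setT (fun t : R => t * s).
    by apply: (Ck_onM openT); [exact: Ck_on_id|exact: Ck_on_cst].
  have [cc ss] := @Ck_on_cos_sin R k.
  apply: (Ck_on_pair openT) => //; apply: (Ck_onD openT); apply: (Ck_on_scale openT);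
    try exact: Ck_on_cst.
  - exact: (Ck_on_comp1 openT _ cc).
  - exact: (Ck_on_comp1 openT _ ss).
- move=> t _; split => //=; rewrite /circle /r /imul /= -[RHS]ca.
  rewrite -[RHS]mulr1 -(cos2Dsin2 (t * s)).
  by rewrite !scale_mulE; ring.
- by rewrite /r mul0r cos0 sin0 scale1r scale0r addr0 g0.
- have ds : is_diff (0 : R) (fun t : R => t * s) (fun t => t * s).
    exact: is_diff_scalel.
  have dc := is_diff_comp1 ds (is_derive_cos _).
  have dn := is_diff_comp1 ds (is_derive_sin _).
  have dr := is_diffD (is_diff_scale dc (is_diff_cst a _))
    (is_diff_scale dn (is_diff_cst (imul a) _)).
  rewrite derive1E (derive_diff (1 : R) (is_diff_pair dr dg)) !fctE mul0r sin0 cos0.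
  by rewrite oppr0 mulr0 mul1r mulr1 !scale0r !scaler0 !scale1r !add0r addr0.
Qed.

(** Converse of [tangent_circle_Mplus]: the defining equations are differentiated along a curve. *)
Lemma tangentP a x (v : ambient l) : tangent (circle_Mplus P) (a, x) v ->
  [/\ exists s, v.1 = s *: imul a, dot v.2 x = 0, bre Q x v.2 = 0 & bim Q K x v.2 = 0].
Proof.
case=> e e0 [g [cg Ng g0 gv]].
have I0 : - e < 0 < e by rewrite oppr_lt0 e0.
have dg := differentiableP (Cinf_differentiable cg I0).
have vE : 'd g 0 1 = v by rewrite -gv derive1E (derive_diff _ dg).
have oI : open [set t : R | - e < t < e] := @open_sym_itv R e.
have d1 := is_diff_comp dg (is_diff_fst _); have d2 := is_diff_comp dg (is_diff_snd _).
have d11 := is_diff_comp d1 (is_diff_fst _); have d12 := is_diff_comp d1 (is_diff_snd _).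
have [[ca /MplusE[x1 nx]]] : circle_Mplus P (a, x) by rewrite -g0; exact: Ng.
have dcirc := is_diffD (is_diff_mul d11 d11) (is_diff_mul d12 d12).
have ddot := is_diff_dot d2 d2.
have dbre := is_diff_dot (is_diff_mulmx Q d2) d2.
have dbim := is_diffN (is_diff_dot (is_diff_mulmx Q (is_diff_mulmx K d2)) d2).
have Mg t : - e < t < e -> dot (g t).2 (g t).2 = 1 /\ null Q K (g t).2.
  by move=> /Ng[_ /MplusE].
have e1 := is_diff_locally_cst oI I0 (fun t It => (Mg t It).1) ddot 1.
have e2 := is_diff_locally_cst oI I0 (fun t It => (Mg t It).2.1) dbre 1.
have e3 := is_diff_locally_cst oI I0 (fun t It => (Mg t It).2.2) dbim 1.
have circ1 t : - e < t < e ->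
    (g t).1.1 * (g t).1.1 + (g t).1.2 * (g t).1.2 = 1.
  by move=> /Ng[+ _]; rewrite /circle /= !expr2.
have e4 := is_diff_locally_cst oI I0 circ1 dcirc 1.
move: e1 e2 e3 e4; rewrite !fctE /= vE g0 /= => e1 e2 e3 e4.
split.
(* The component of [v.1] on the unit vector [imul a]. *)
- exists (a.1 * v.1.2 - a.2 * v.1.1).
  have {}e4 : a.1 * v.1.1 + a.2 * v.1.2 = 0 by move: e4; lra.
  move: ca e4; rewrite /circle /imul /=; case: v.1 => v1 v2 /= ca e4.
  congr (_, _); rewrite /= scale_mulE.
    rewrite -[v1 in LHS]mulr1 -ca -[LHS]subr0 -[X in _ - X](mulr0 a.1) -e4; ring.
  rewrite -[v2 in LHS]mulr1 -ca -[LHS]subr0 -[X in _ - X](mulr0 a.2) -e4; ring.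
- by move: e1; rewrite (dotC x); lra.
- move: e2; rewrite -!/(bre _ _ _) (breC HQK v.2).
  by move=> e2; rewrite /bre in e2 *; lra.
- move: e3; rewrite opprD -!/(bim _ _ _ _) (bimC HQK v.2).
  by move=> e3; rewrite /bim in e3 *; lra.
Qed.

(** * [J] expressed through [K] *)

Section ComplexStructure.
Variable J : @ambient R l -> @ambient R l -> @ambient R l.
Hypothesis JP : is_J P J.

(** [X] is split as b [eta] + X' with X' in [V]. Linearity of [J] is available on tangent vectors
    only, so each piece is first shown tangent. *)
Lemma J_tangent a x s X : circle a -> Mplus P x -> dot X x = 0 ->
  bre Q x X = 0 -> bim Q K x X = 0 ->
  let b := dot X (K *m x) in
  J (a, x) (s *: imul a, X) =
    (- b *: imul a, s *: (K *m x) + K *m (X - b *: (K *m x))).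
Proof.
move=> ca Mx Xx r0 i0 b; have [Jlin Jeps Jeta JV] := JP ca Mx.
have [x1 [nr ni]] := (MplusE x).1 Mx.
have Kx0 : dot (K *m x) x = 0 by rewrite dotC (dotxK HQK).
have Kr : bre Q x (K *m x) = 0 by rewrite (bre_mulK HQK) ni oppr0.
have Ki : bim Q K x (K *m x) = 0 by rewrite (bim_mulK HQK).
pose X' := X - b *: (K *m x).
have X'x : dot X' x = 0 by rewrite dotDl dotNl dotZl Kx0 Xx mulr0 subr0.
have X'r : bre Q x X' = 0 by rewrite breB r0 /bre dotZr -/(bre _ _ _) Kr mulr0 subr0.
have X'i : bim Q K x X' = 0.
  by rewrite bimB i0 /bim dotZr -mulrN -/(bim _ _ _ _) Ki mulr0 subr0.
have T s' Y : dot Y x = 0 -> bre Q x Y = 0 -> bim Q K x Y = 0 ->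
  tangent (circle_Mplus P) (a, x) (s' *: imul a, Y) by exact: tangent_circle_Mplus.
have T0 Y : dot Y x = 0 -> bre Q x Y = 0 -> bim Q K x Y = 0 ->
  tangent (circle_Mplus P) (a, x) (0, Y) by move=> *; rewrite -(scale0r (imul a)); exact: T.
have Te : tangent (circle_Mplus P) (a, x) (imul a, 0).
  rewrite -(scale1r (imul a)); apply: T; rewrite /bre /bim -(scale0r x) ?dotZl ?dotZr;
    by rewrite mul0r ?oppr0.
have JX' : J (a, x) (0, X') = (0, K *m X').
  apply: JV; split; first exact: tangent_focal.
  by rewrite /eta dotDl dotNl dotZl (dotKK HQK) x1 mulr1 subrr.
have JX : J (a, x) (0, X) = (- b *: imul a, K *m X').
  rewrite (_ : (0, X) = b *: (0, eta P x) + (0, X')); last first.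
    by congr (_, _); rewrite /= ?scaler0 ?addr0// /X' /eta addrC subrK.
  rewrite Jlin ?JX' ?Jeta//; [|exact: T0|exact: T0].
  congr (_, _) => /=; first by rewrite addr0 scalerN scaleNr.
  by rewrite oppr0 scaler0 add0r.
rewrite (_ : (s *: imul a, X) = s *: (imul a, 0) + (0, X)); last first.
  by congr (_, _); rewrite /= ?scaler0 ?addr0 ?add0r.
rewrite Jlin ?JX ?Jeps//; last exact: T0.
by congr (_, _); rewrite /= ?scaler0 ?add0r.
Qed.

(** For [y] tangent to the cone, [polar] intertwines [K] with [J]. The radial part of [K y] is <x, K
    y> = - <y, K x>, the coefficient that [J] gives to [epsilon]. *)
Lemma J_polar a x y : circle a -> Mplus P x -> bre Q x y = 0 -> bim Q K x y = 0 ->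
  J (a, x) (polar (a, x) y) = polar (a, x) (K *m y).
Proof.
move=> ca Mx yr yi; have [x1 [nr ni]] := (MplusE x).1 Mx.
rewrite /polar /= J_tangent//; last first.
- rewrite bimB yi /bim dotZr -mulrN -/(bim _ _ _ _) ni mulr0 subr0 //.
- rewrite breB yr /bre dotZr -/(bre _ _ _) nr mulr0 subr0 //.
- by rewrite dotDl dotNl dotZl x1 mulr1 (dotC y) subrr.
rewrite dotDl dotNl dotZl (dotxK HQK) mulr0 subr0 (dotKv HQK x y).
congr (_, _); rewrite !mulmxBr -!scalemxAr (KKv HQK).
by move: (K *m x) (K *m y) => u v; apply/colP => i; rewrite !mxE; ring.
Qed.

(** [J] rotates the orthonormal pair [epsilon], [eta] and acts on [V] through the orthogonal matrix
    [K]. *)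
Lemma J_isometry p (v w : ambient l) : circle_Mplus P p ->
  tangent (circle_Mplus P) p v -> tangent (circle_Mplus P) p w ->
  product_metric p (J p v) (J p w) = product_metric p v w.
Proof.
case: p => a x [/= ca Mx]; have [x1 _] := (MplusE x).1 Mx.
case: v w => [u X] [v Y] /tangentP[/= [s ->] X0 Xr Xi] /tangentP[/= [t ->] Y0 Yr Yi].
rewrite !J_tangent// /product_metric /= !scale_mulE.
have xK : dot x (K *m x) = 0 by exact: (dotxK HQK).
have Kx : dot (K *m x) x = 0 by rewrite dotC.
have a1 : a.1 * a.1 + a.2 * a.2 = 1 by rewrite -!expr2.
rewrite (scalemxAr s) (scalemxAr t) -!mulmxDr (dotKK HQK).
rewrite !(dotDl, dotDr, dotNl, dotNr, dotZl, dotZr).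
rewrite (dotKK HQK) x1 X0 (dotC x Y) Y0 Kx xK (dotC (K *m x) Y).
move: (dot X (K *m x)) (dot Y (K *m x)) => b b'.
rewrite [LHS](_ : _ = b * b' * (a.1 * a.1 + a.2 * a.2) + s * t - b * b' + dot X Y); last by ring.
rewrite [RHS](_ : _ = s * t * (a.1 * a.1 + a.2 * a.2) + dot X Y); last by ring.
by rewrite a1; ring.
Qed.

End ComplexStructure.

End Focal.

(** * Holomorphic charts *)

Section Charts.
Context {R : realType} {l : nat} (P : 'I_2 -> 'M[R]_(2 * l)).
Hypothesis HP : symmetric_clifford_system P.
Implicit Types (a : R * R) (x y z X : 'cV[R]_(2 * l)).

Local Notation Q := (P 0).
Local Notation K := (P 0 *m P 1).
Let HQK := clifford_real_structure HP.

Section Chart.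
Variables (k : nat) (x : 'cV[R]_(2 * l)) (t : R).
Variables (A : 'M[R]_(2 * l, k)) (B1 B2 : 'M[R]_(k, 2 * l)).

Definition embed (u : Cvec k) : 'cV[R]_(2 * l) := A *m u.1 + K *m A *m u.2.
Definition proj z : @Cvec R k := (B1 *m z, B2 *m z).
Definition cone_point u := stereo Q K x (embed u).

Definition chart_set : set (ambient l) :=
  (fst @^-1` half_plane t) `&` (snd @^-1` admissible K x).

(** The condition on [theta] keeps the logarithm of the norm where [atan] inverts [tan], so that
    [unroll t] undoes [normalize]. *)
Definition focal_chart : chart (@ambient R l) k :=
  @Chart R (ambient l) k (circle_Mplus P `&` chart_set)
    [set u | admissible K x (embed u) /\ - (pi / 2) < theta (cone_point u) - t < pi / 2]
    (fun p => proj (unroll t p))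
    (fun u => normalize (cone_point u)).

(* [embed] parametrises a complement of the complex line spanned by [Q x], and
   [proj] is the projection onto it. *)
Definition complement : Prop :=
  (forall z, exists c d, z = embed (proj z) + c *: (Q *m x) + d *: (K *m (Q *m x))) /\
  (forall u c d, proj (embed u + c *: (Q *m x) + d *: (K *m (Q *m x))) = u).

Hypotheses (Mx : Mplus P x) (comp : complement).

Let nx : null Q K x. Proof. by have [] := (MplusE HP x).1 Mx. Qed.

Lemma embed_imul u : embed (imul u) = K *m embed u.
Proof.
by rewrite /embed /imul /= -!(mulmxA K A) mulmxN mulmxDr (KKv HQK) addrC.
Qed.

(** The kernel of the projection is a complex line, hence stable under [K], and so is the complement
    parametrised by [embed]. *)
Lemma proj_mulK z : proj (K *m z) = imul (proj z).
Proof.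
have [c [d zE]] := comp.1 z; rewrite [in LHS]zE 2!mulmxDr -!scalemxAr (KKv HQK).
rewrite -embed_imul scalerN -scaleNr -addrA [c *: _ + _]addrC addrA.
exact: comp.2.
Qed.

Lemma cone_pointP u : admissible K x (embed u) ->
  [/\ null Q K (cone_point u), admissible K x (cone_point u),
      cone_point u != 0 & proj (cone_point u) = u].
Proof.
move=> au; have ac : admissible K x (cone_point u).
  by rewrite /admissible; have [-> ->] := stereo_dot HQK nx (embed u).
split=> //; first exact: (stereo_null HQK nx).
- exact: admissible_neq0 ac.
- exact: comp.2.
Qed.

(** [z] and [embed (proj z)] lie on the same line directed by [Q x], which meets the cone once. *)
Lemma cone_point_proj z : null Q K z -> admissible K x z ->
  admissible K x (embed (proj z)) /\ cone_point (proj z) = z.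
Proof.
move=> nz az; have [c [d zE]] := comp.1 z.
have ae : admissible K x (embed (proj z)).
  move: az; rewrite /admissible {1 2 3 4}zE.
  by have [-> ->] := shift_dot HQK nx (embed (proj z)) c d.
by split=> //; rewrite /cone_point [RHS]zE; apply: (stereo_shift HQK nx) => //; rewrite -zE.
Qed.

Lemma embed_is_diff w : is_diff w embed embed.
Proof.
exact: (is_diffD (is_diff_mulmx A (is_diff_fst w)) (is_diff_mulmx (K *m A) (is_diff_snd w))).
Qed.

Lemma Ck_on_embed n (U : set (Cvec k)) : open U -> Ck_on n U embed.
Proof.
move=> oU; apply: Ck_onD => //; apply: Ck_on_mulmx => //.
  exact: Ck_on_fst.
exact: Ck_on_snd.
Qed.

Lemma Ck_on_proj n (V : normedModType R) (U : set V) f :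
  open U -> Ck_on n U f -> Ck_on n U (fun v => proj (f v)).
Proof. by move=> oU cf; apply: Ck_on_pair => //; exact: Ck_on_mulmx. Qed.

Lemma open_embed : open [set u | admissible K x (embed u)].
Proof.
rewrite (_ : mkset _ = embed @^-1` admissible K x)//.
apply: open_comp => [u _|]; last exact: open_admissible.
exact: (Ck_on_embed 0 openT).
Qed.

Lemma Ck_on_chart_inv n : Ck_on n [set u | admissible K x (embed u)] (chart_inv focal_chart).
Proof.
apply: (Ck_on_normalize open_embed) => [u /cone_pointP[]//|].
by apply: (Ck_on_stereo Q open_embed) => //; exact: Ck_on_embed open_embed.
Qed.

Lemma chart_inv_dom u : chart_cod focal_chart u -> chart_dom focal_chart (chart_inv focal_chart u).
Proof.
move=> [au tu]; have [nz az z0 _] := cone_pointP au.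
have e0 : expR (- theta (cone_point u)) != 0 by rewrite lt0r_neq0// expR_gt0.
split; [split|split] => /=.
- exact: circle_cis.
- by apply/(MplusE HP); split; [exact: dot_normalize|exact: null_scale].
(* The half plane condition on [cis (theta z)] is cos (theta z - t) > 0. *)
- by rewrite /half_plane /= -cosB; exact: cos_gt0_pihalf.
- exact: admissible_scale.
Qed.

Lemma chart_mapP p : chart_dom focal_chart p -> chart_cod focal_chart (chart_map focal_chart p) /\
  chart_inv focal_chart (chart_map focal_chart p) = p.
Proof.
case: p => a y [[/= ca My] [/= ha ay]]; have [y1 ny] := (MplusE HP y).1 My.
have e0 : expR (angle t a) != 0 by rewrite lt0r_neq0// expR_gt0.
have [||ae ce] := @cone_point_proj (unroll t (a, y)).
- exact: null_scale.
- exact: admissible_scale.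
have [nE tE] := normalize_unroll ca ha y1.
by rewrite /= /chart_map /= ce; split.
Qed.

Lemma focal_is_chart : is_chart (circle_Mplus P) focal_chart.
Proof.
have ocod : open (chart_cod focal_chart).
  (* Continuity of [theta (cone_point v)] is available on the admissible set only, so openness is
     checked at each point. *)
  rewrite openE => u [au tu]; rewrite /interior.
  have : \forall v \near u, - (pi / 2) < theta (cone_point v) - t < pi / 2.
    have ct : Ck_on 0 [set u | admissible K x (embed u)] (fun v => theta (cone_point v) - t).
      apply: (Ck_onD open_embed); last exact: Ck_on_cst.
      apply: (Ck_on_theta open_embed) => [v /cone_pointP[]//|].
      by apply: (Ck_on_stereo Q open_embed) => //; exact: Ck_on_embed open_embed.
    have /(_ _ au) := ct; rewrite /prop_for /continuous_at => cu.
    case/andP: tu => t1 t2; near=> v; apply/andP; split.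
      by near: v; exact: (cvgr_gt _ cu).
    by near: v; exact: (cvgr_lt _ cu).
  apply: filterS2 (open_nbhs_nbhs (conj open_embed au)) => v av tv.
  by split.
have oset : open chart_set.
  apply: openI; first exact: open_half_plane.
  by apply: open_comp => [p _|]; [exact: cvg_snd|exact: open_admissible].
split => //; first by exists chart_set.
- by split=> p; [move=> /chart_mapP[]|rewrite inE => /chart_mapP[]].
- split=> [u|u]; first exact: chart_inv_dom.
  rewrite inE => -[au tu]; have [nz az z0 pE] := cone_pointP au.
  by rewrite /= unroll_normalize.
- split=> p.
    (* The formulas for the chart and its inverse are already smooth on open sets of the ambient
       spaces, and serve as their own extensions. *)
    move=> [Np sp]; exists chart_set, (chart_map focal_chart); split=> //.
    move=> n; apply: (Ck_on_proj oset); apply: Ck_on_sub (Ck_on_unroll n t).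
    exact: subIsetl.
  move=> [ap _]; exists [set u | admissible K x (embed u)], (chart_inv focal_chart).
  by split=> //; [exact: open_embed|move=> n; exact: Ck_on_chart_inv].
Unshelve. all: by end_near. Qed.

(** The differential of [cone_point] divided by the norm of the point, the form in which
    [is_diff_normalize] takes its argument. *)
Definition dcone (u v : Cvec k) : 'cV[R]_(2 * l) :=
  expR (- theta (cone_point u)) *: 'd (stereo Q K x) (embed u) (embed v).

Lemma is_diff_chart_inv u : admissible K x (embed u) ->
  is_diff u (chart_inv focal_chart) (fun v => polar (chart_inv focal_chart u) (dcone u v)).
Proof.
move=> au; have [_ _ z0 _] := cone_pointP au.
have ds := differentiableP (diff_stereo Q au).1.
exact: (is_diff_comp (is_diff_comp (embed_is_diff u) ds) (is_diff_normalize z0)).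
Qed.

Lemma dcone_imul u v : admissible K x (embed u) -> dcone u (imul v) = K *m dcone u v.
Proof.
by move=> au; rewrite /dcone embed_imul (diff_stereoK HQK nx) // scalemxAr.
Qed.

Lemma dcone_tangent u v : admissible K x (embed u) ->
  bre Q (chart_inv focal_chart u).2 (dcone u v) = 0 /\
  bim Q K (chart_inv focal_chart u).2 (dcone u v) = 0.
Proof.
move=> au; have [h0 h1] := diff_stereo_tangent HQK nx (embed v) au.
rewrite /bre /bim /= -!scalemxAr !dotZl !dotZr -/(bre _ _ _) h0 !mulr0.
by split=> //; rewrite -!mulrN -/(bim _ _ _ _) h1 !mulr0.
Qed.

Lemma chart_induced (J : @ambient R l -> @ambient R l -> @ambient R l) u v :
  is_J P J -> chart_cod focal_chart u ->
  'd (chart_inv focal_chart) u (imul v) =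
    J (chart_inv focal_chart u) ('d (chart_inv focal_chart) u v).
Proof.
move=> JP cu; have [[ca My] _] := chart_inv_dom cu; have [au _] := cu.
have [h0 h1] := dcone_tangent v au.
rewrite !(@diff_val _ _ _ _ _ _ _ (is_diff_chart_inv au)) (dcone_imul v au).
by rewrite [chart_inv focal_chart u]surjective_pairing (J_polar HP JP).
Qed.

End Chart.

(** The differential of [unroll] cancels [polar], leaving the projection of a real multiple of
    [dcone], which commutes with i. A different branch of the argument changes only that positive
    factor. *)
Lemma chart_transition k x t (A : 'M[R]_(2 * l, k)) B1 B2 x' t' (A' : 'M[R]_(2 * l, k)) B1' B2' :
  Mplus P x -> complement x A B1 B2 -> complement x' A' B1' B2' ->
  let c := focal_chart x t A B1 B2 in let d := focal_chart x' t' A' B1' B2' in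
  holomorphic_on (chart_cod c `&` chart_inv c @^-1` chart_dom d)
    (chart_map d \o chart_inv c).
Proof.
move=> Mx comp comp' c d w [[aw _] [_ [hw _]]].
have dc := is_diff_chart_inv t Mx comp aw.
have [/differentiableP du duE] := diff_unroll hw.
have df := is_diff_comp dc du.
have dm := is_diff_pair (is_diff_mulmx B1' df) (is_diff_mulmx B2' df).
have dE v : 'd (chart_map d \o chart_inv c) w v =
    proj B1' B2' (expR (angle t' (chart_inv c w).1) *: dcone x A w v).
  rewrite (@diff_val _ _ _ _ _ _ _ dm) /= /polar duE.
  by congr (_, _); congr (_ *m (_ *: _)); rewrite addrC subrK.
apply: cauchy_riemann; first exact: (@ex_diff _ _ _ _ _ _ _ dm).
by move=> v; rewrite !dE (dcone_imul Mx) // scalemxAr (proj_mulK comp').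
Qed.

Lemma complement_ex k x : (2 * l = 2 * k.+1)%N -> Mplus P x ->
  exists (A : 'M[R]_(2 * l, k)) B1 B2, complement x A B1 B2.
Proof.
move=> lk /(MplusE HP)[x1 _]; have [_ _ QQ KK _] := HQK.
have Qx0 : Q *m x != 0.
  apply: contra_eq_neq x1 => Qx0; rewrite -[x](QQv HQK) Qx0 mulmx0.
  by rewrite -(scale0r x) dotZl mul0r eq_sym oner_eq0.
have [A [B1 [B2 [h1 h2]]]] := complex_complement KK Qx0 lk.
exists A, B1, B2; split=> [z|u c d]; first exact: h1.
by have [e1 e2] := h2 u.1 u.2 c d; rewrite /proj e1 e2; case: u {e1 e2}.
Qed.

Lemma half_plane_cover a : circle a -> exists t, half_plane t a.
Proof.
case: a => a1 a2; rewrite /circle /half_plane /= => ca.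
have [a1p|a1n|a10] := ltgtP 0 a1.
- by exists 0; rewrite cos0 sin0 mulr1 mulr0 addr0.
- by exists pi; rewrite cospi sinpi mulr0 addr0 mulrN1 oppr_gt0.
have [a2p|a2n|a20] := ltgtP 0 a2.
- by exists (pi / 2); rewrite cos_pihalf sin_pihalf mulr0 add0r mulr1.
- by exists (- (pi / 2)); rewrite cosN sinN cos_pihalf sin_pihalf mulr0 add0r mulrN1 oppr_gt0.
by move/eqP: ca; rewrite -a10 -a20 expr0n addr0 eq_sym oner_eq0.
Qed.

Lemma circle_Mplus_integrable (J : @ambient R l -> @ambient R l -> @ambient R l) :
  (0 < l)%N -> is_J P J -> integrable_acs (circle_Mplus P) J.
Proof.
(* The cone is a complex hypersurface of C^l. *)
move=> l0 JP; exists l.-1.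
have lk : (2 * l = 2 * l.-1.+1)%N by rewrite prednK.
exists [set c | exists x t A B1 B2,
  [/\ Mplus P x, complement x A B1 B2 & c = focal_chart x t A B1 B2]].
  split.
  - by move=> _ [x [t [A [B1 [B2 [Mx comp ->]]]]]]; exact: focal_is_chart.
  - move=> [a x] [/= ca Mx]; have [t ha] := half_plane_cover ca.
    have [A [B1 [B2 comp]]] := complement_ex lk Mx.
    exists (focal_chart x t A B1 B2); first by exists x, t, A, B1, B2.
    (* The chart is centred at [x] itself, where [dot x x = 1]. *)
    split=> //; split=> //=; apply: admissible_unit => //.
    by have [] := (MplusE HP x).1 Mx.
  - move=> _ _ [x [t [A [B1 [B2 [Mx comp ->]]]]]] [x' [t' [A' [B1' [B2' [_ comp' ->]]]]]].
    exact: chart_transition.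
move=> _ [x [t [A [B1 [B2 [Mx comp ->]]]]]] u cu v.
exact: chart_induced.
Qed.

End Charts.

Theorem theorem1 (R : realType) (l : nat) (P : 'I_2 -> 'M[R]_(2 * l))
    (J : ambient l -> ambient l -> ambient l) :
  (3 <= l)%N ->
  symmetric_clifford_system P ->
  is_J P J ->
  integrable_acs (circle_Mplus P) J /\
  hermitian_manifold (circle_Mplus P) J (product_metric (l := l)).
Proof.
move=> l3 HP JP; have acs := circle_Mplus_integrable HP (ltn_trans (isT : 0 < 2)%N l3) JP.
by split=> //; split=> // p X Y Np TX TY; exact: (J_isometry HP JP).
Qed.
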